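(* For $n\geq 1$ let $x_{n,1}<x_{n,2}<\dots<x_{n,n}=0$ be the $n$ (real, distinct) roots of the Eulerian polynomial $A_n(x)=\sum_{k=1}^n A(n,k)x^k$, and let $$\mu_n=\frac{1}{n}\sum_{k=1}^n \delta_{-x_{n,k}}.$$ Then, as $n\to\infty$, the sequence of probability measures $\mu_n$ converges weakly to a probability measure $\mu$ with support $[0,\infty)$. This measure $\mu$ is the distribution of $\exp(\pi Z)$, where $Z$ is a standard Cauchy random variable; equivalently, $\mu$ has density $$\frac{1}{t\left(\log^2 t+\pi^2\right)}\,1_{t>0}.$$
   Context: For $1\leq k\leq n$, $A(n,k)$ denotes the Eulerian number, i.e. the number of permutations of $\{1,\dots,n\}$ with exactly $k-1$ descents. It is a classical fact that $A_n(x)=\sum_{k=1}^n A(n,k)x^k$ has $n$ distinct real roots, all nonpositive, the largest being $0$. $\delta_a$ denotes the Dirac mass at $a$. *)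

(* Defs.v *)
From HB Require Import structures.
From mathcomp Require Import all_boot all_order all_algebra all_fingroup.
From mathcomp Require Import all_classical all_reals all_analysis.
From mathcomp Require Import measurable_realfun.

Set Implicit Arguments.
Unset Strict Implicit.
Unset Printing Implicit Defensive.

Import Order.TTheory GRing.Theory Num.Theory.
Import numFieldNormedType.Exports.

Local Open Scope classical_set_scope.
Local Open Scope ring_scope.

Definition descents (n : nat) (s : 'S_n) : {set 'I_n} :=
  [set i : 'I_n | [exists j : 'I_n, (j == i.+1 :> nat) && (s j < s i)%N]].

(* [k] is one more than the number of descents, so [eulerian_number n 0 = 0]. *)
Definition eulerian_number (n k : nat) : nat :=
  #|[set s : 'S_n | #|descents s|.+1 == k]%SET|.

Definition eulerian_poly (R : realType) (n : nat) : {poly R} :=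
  \sum_(1 <= k < n.+1) (eulerian_number n k)%:R *: 'X^k.

(* [y 1], ..., [y n] are the roots of the n-th Eulerian polynomial, listed in
   increasing order (for 1 <= n); the other values of [y] are irrelevant. *)
Record eulerian_roots (R : realType) (n : nat) (y : nat -> R) : Prop :=
  EulerianRoots {
    eulerian_roots_incr : forall j k : nat,
      (1 <= j)%N -> (j < k)%N -> (k <= n)%N -> y j < y k ;
    eulerian_rootsP : forall z : R,
      root (eulerian_poly R n) z <-> exists2 k : nat, (1 <= k <= n)%N & z = y k ;
    eulerian_roots_max : y n = 0
  }.

(* [msum _ n] sums over 0 <= k < n, hence the shift to [y 1], ..., [y n]. *)
Definition root_measure (R : realType) (y : nat -> R) (n : nat) :
    set R -> \bar R :=
  mscale (n%:R^-1)%:nng (msum (fun k : nat => dirac (- y k.+1)) n).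

HB.instance Definition _ (R : realType) (y : nat -> R) (n : nat) :=
  Measure.on (@root_measure R y n).

Lemma root_measure_setT (R : realType) (y : nat -> R) (n : nat) :
  @root_measure R y n.+1 setT = 1%E.
Proof.
rewrite /root_measure /mscale /= /msum.
rewrite (eq_bigr (fun=> 1%:E)) => [|k _]; last exact: diracT.
by rewrite sumEFin -EFinM sumr_const card_ord mulVf// pnatr_eq0.
Qed.

HB.instance Definition _ (R : realType) (y : nat -> R) (n : nat) :=
  Measure_isProbability.Build _ _ _ (@root_measure R y n.+1)
    (@root_measure_setT R y n).

Definition weakly_converges (R : realType)
    (mu_ : nat -> probability R R) (mu : probability R R) : Prop :=
  forall f : R -> R, continuous f -> (exists M : R, forall t, `|f t| <= M) ->
    (\int[mu_ n]_t (f t)%:E)%E @[n --> \oo] --> (\int[mu]_t (f t)%:E)%E.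

Definition measure_support (R : realType) (mu : probability R R) : set R :=
  [set t | forall U : set R, open U -> U t -> (0 < mu U)%E].

Definition has_density (R : realType) (mu : probability R R) (f : R -> R) :
    Prop :=
  [/\ measurable_fun setT f, forall t, 0 <= f t &
      forall A : set R, measurable A ->
        mu A = (\int[@lebesgue_measure R]_(t in A) (f t)%:E)%E].

Definition standard_cauchy_pdf (R : realType) (t : R) : R :=
  (pi * (1 + t ^+ 2))^-1.

Definition exp_pi (d : measure_display) (T : measurableType d) (R : realType)
    (Z : T -> R) : T -> R :=
  fun w => expR (pi * Z w).

Lemma measurable_exp_pi (d : measure_display) (T : measurableType d)
  (R : realType) (Z : {mfun T >-> R}) : measurable_fun setT (exp_pi Z).
Proof.
by apply: measurableT_comp => //; exact: measurable_funM.
Qed.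

HB.instance Definition _ (d : measure_display) (T : measurableType d)
    (R : realType) (Z : {mfun T >-> R}) :=
  isMeasurableFun.Build _ _ _ _ (exp_pi Z) (measurable_exp_pi Z).

(* Main.v *)
(* [f_n(x) = A_n(x) / (1 - x)^(n+1)] is [(x d/dx)^n] applied to [1 / (1 - x)], so
   at [x = - e^u] it is the n-th derivative of [1 / (1 + e^u)], a sum of
   [(-1)^(n+1) n! (u + i pi (2m+1))^-(n+1)] over the poles.  That expansion is
   obtained here as the limit [N -> oo] of a finite identity: the decomposition of
   [f_n(- x^N)] over the N-th roots of -1.  The two poles nearest to the real line
   dominate, and with [u = pi cot theta] their contribution is
   [2 (-1)^(n+1) n! (sin theta / pi)^(n+1) cos ((n+1) theta)].  Hence the sign of
   [A_n(- e^u)] alternates at [theta = j pi / (n+1)], which yields enough roots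
   to see that the angles of the roots become equidistributed in ]0, pi[: this
   says that [u / pi = cot theta] is Cauchy in the limit. *)

Require Import Defs.
From HB Require Import structures.
From mathcomp Require Import all_boot all_order all_algebra all_fingroup.
From mathcomp Require Import all_classical all_reals all_analysis.
From mathcomp Require Import measurable_realfun complex ring lra zify.

Set Implicit Arguments.
Unset Strict Implicit.
Unset Printing Implicit Defensive.

Import Order.TTheory GRing.Theory Num.Theory.
Import numFieldNormedType.Exports.

Local Open Scope ring_scope.

(** * Eulerian polynomials and descents *)

(** The nearest two poles are at squared distance [u^2 + pi^2], the next ones at [u^2 + 9 pi^2]. The
    ratio tends to 1 as [u] grows, so the dominance is uniform only for bounded [u], and nothing
    uniform is available near the ends of ]0, pi[. Roots are therefore located only in compact parts
    of ]0, +oo[, where sign changes bound their number from below. Lower bounds are enough: the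
    limit law has total mass 1 on ]0, +oo[, so they pass to integrals of bounded nonnegative
    functions, and the upper bound for [f] is the lower bound for [M - f]. Working with finite N
    replaces an infinite expansion by a polynomial identity. Only the two dominant terms are taken
    to the limit; the other N - 2 are bounded uniformly in N, and one large N then decides the
    sign. *)

Fixpoint eulerian_rec (R : nzRingType) (n : nat) : {poly R} :=
  if n is m.+1 then
    'X * (1 - 'X) * (eulerian_rec R m)^`() + m.+1%:R *: ('X * eulerian_rec R m)
  else 1.

(** Injectivity is enough, both sides having [(n+1)!] elements; [i] is recovered as the preimage of
    [j0]. *)
Lemma lift_perm_pair_bij n (j0 : 'I_n.+1) :
  bijective (fun p : 'I_n.+1 * 'S_n => lift_perm p.1 j0 p.2).
Proof.
apply: inj_card_bij; last by rewrite card_prod !card_Sn card_ord factS.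
move=> [i s] [j t] /= E; have ij : i = j.
  by apply: (@perm_inj _ (lift_perm i j0 s)); rewrite lift_perm_id E lift_perm_id.
rewrite -ij in E *; congr pair; apply/permP => k; apply: (@lift_inj _ j0).
by rewrite -!(lift_perm_lift i) E.
Qed.

Lemma sum_perm_lift (V : nmodType) n (j0 : 'I_n.+1) (F : 'S_n.+1 -> V) :
  \sum_s F s = \sum_i \sum_(t : 'S_n) F (lift_perm i j0 t).
Proof. by rewrite pair_bigA (reindex _ (onW_bij _ (lift_perm_pair_bij j0))). Qed.

Lemma descent_neq_max n (t : 'S_n.+1) (k : 'I_n.+1) :
  k \in descents t -> k != ord_max.
Proof.
rewrite inE => /existsP[j /andP[/eqP jk _]].
by apply/eqP => km; have := ltn_ord j; rewrite jk km /= ltnn.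
Qed.

Lemma card_descents_le n (t : 'S_n.+1) : (#|descents t| <= n)%N.
Proof.
have : descents t \subset [set~ ord_max].
  by apply/fintype.subsetP => k /descent_neq_max; rewrite !inE.
by move=> /subset_leq_card; rewrite cardsC1 card_ord.
Qed.

(** In one-line notation, [lift_perm i ord_max t] inserts the largest value at position [i] of the
    word of [t]. This creates a descent at [i], unless [i] is the end of the word, and destroys the
    descent, if any, between the two letters that it separates. *)
Lemma descents_lift n (i : 'I_n.+1) (t : 'S_n) :
  descents (lift_perm i ord_max t) =
  (if i == ord_max then finset.set0 else [set i]) :|:
  [set lift i k | k in descents t :\: [set k : 'I_n | k.+1 == i :> nat]].
Proof.
have E (j : 'I_n.+1) : j != i -> exists k, j = lift i k.
  by move=> ji; case: (unliftP i j) => [k ->|ji']; [exists k|rewrite ji' eqxx in ji].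
apply/finset.setP => p; rewrite !inE.
case: (eqVneq p i) => [-> |pi].
  have -> : (i \in [set lift i k | k in
      descents t :\: [set k : 'I_n | k.+1 == i :> nat]]) = false.
    by apply/imsetP => -[k _ /eqP]; rewrite (negbTE (neq_lift i k)).
  rewrite orbF; case: (eqVneq i ord_max) => [->|im]; rewrite !inE ?eqxx.
    apply/existsP => -[j /andP[/eqP jE _]].
    by have := ltn_ord j; rewrite jE ltnn.
  have hi : (i.+1 < n.+1)%N.
    rewrite ltnS ltn_neqAle -ltnS ltn_ord andbT.
    by apply: contra im => /eqP h; apply/eqP/val_inj.
  apply/existsP; exists (Ordinal hi); rewrite eqxx /= lift_perm_id.
  have [k ->] : exists k, Ordinal hi = lift i k.
    by apply: E; rewrite -val_eqE /= neq_ltn ltnSn orbT.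
  by rewrite lift_perm_lift lift_max ltn_ord.
have [k kE] := E p pi; subst p.
rewrite mem_imset; last exact: lift_inj.
have -> : (lift i k \in (if i == ord_max then finset.set0 else [set i])) = false.
  by case: ifP; rewrite !inE // (negbTE pi).
rewrite !inE /=.
apply/existsP/andP => [[j]|[nki /existsP[j /andP[/eqP jk lt]]]].
  rewrite lift_perm_lift lift_max => /andP[/eqP jE].
  case: (unliftP i j) => [k'|] jE'; last first.
    by rewrite jE' lift_perm_id /= ltnNge ltnW // ltn_ord.
  rewrite jE' lift_perm_lift lift_max => lt.
  have e : bump i k' = (bump i k).+1 :> nat.
    by rewrite -[bump i k']/(val (lift i k')) -jE'; exact: jE.
  move: e; rewrite /bump => e; split; last first.
    apply/existsP; exists k'; rewrite lt andbT; apply/eqP.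
    by move: e; case: (leqP i k'); case: (leqP i k) => /=; lia.
  by apply/eqP => e2; move: e; case: (leqP i k'); case: (leqP i k) => /=; lia.
exists (lift i j); rewrite !lift_perm_lift !lift_max lt andbT /= /bump jk.
by apply/eqP; move: nki => /eqP; case: (leqP i k); case: (leqP i k.+1) => /=; lia.
Qed.

Lemma card_descents_lift n (i : 'I_n.+1) (t : 'S_n) :
  #|descents (lift_perm i ord_max t)| =
  ((i != ord_max) + #|descents t :\: [set k : 'I_n | k.+1 == i :> nat]|)%N.
Proof.
rewrite descents_lift cardsU disjoint_setI0 ?cards0 ?subn0; last first.
  rewrite disjoint_subset; apply/fintype.subsetP => p; case: ifP; rewrite !inE // => _ /eqP ->.
  by apply/imsetP => -[k _ /eqP]; rewrite (negbTE (neq_lift i k)).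
rewrite card_imset; last exact: lift_inj.
by congr addn; case: ifP; rewrite ?cards0 ?cards1.
Qed.

(** A word of length [n+1] with [d] descents has [n+2] places for a new maximum. The [d] places
    inside a descent and the end of the word keep the number of descents; the other [n+1-d] places
    raise it by one. *)
Lemma sum_descents_lift (R : comNzRingType) n (t : 'S_n.+1) :
  \sum_i 'X^(#|descents (lift_perm i ord_max t)|.+1) =
  'X * (1 - 'X) * ('X^(#|descents t|.+1))^`()
   + n.+2%:R *: ('X * 'X^(#|descents t|.+1)) :> {poly R}.
Proof.
set d := #|descents t|.
have dn : (d <= n)%N := card_descents_le t.
(* Position 0 is treated apart: no pair of letters is separated there, so a descent is always
   gained. The remaining positions are indexed by the letter [k] just before the insertion. *)
rewrite big_ord_recl card_descents_lift.
have -> : descents t :\: [set k : 'I_n.+1 | k.+1 == (ord0 : 'I_n.+2) :> nat] = descents t.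
  by apply/finset.setP => k; rewrite !inE.
have E (k : 'I_n.+1) : #|descents (lift_perm (lift ord0 k) ord_max t)| =
   if (k \in descents t) || (k == ord_max) then d else d.+1.
  rewrite card_descents_lift.
  have -> : [set k0 : 'I_n.+1 | k0.+1 == lift ord0 k :> nat] = [set k].
    by apply/finset.setP => j; rewrite !inE /= /bump leq0n add1n eqSS.
  have -> : (lift ord0 k != ord_max) = (k != ord_max).
    by rewrite -!val_eqE /= /bump leq0n add1n eqSS.
  have := cardsD1 k (descents t); rewrite -/d => ->.
  case: (boolP (k \in descents t)) => [/descent_neq_max -> //|nk /=].
  by rewrite add0n; case: eqVneq => [//|_]; rewrite !add1n.
under eq_bigr do rewrite E.
rewrite (bigID (fun k => (k \in descents t) || (k == ord_max))) /=.
rewrite (eq_bigr (fun=> 'X^(d.+1) : {poly R})); last by move=> k ->.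
rewrite [X in _ + (_ + X)](eq_bigr (fun=> 'X^(d.+2) : {poly R})); last by move=> k /negbTE ->.
rewrite !sumr_const.
have c1 : #|[pred k | (k \in descents t) || (k == ord_max)]| = d.+1.
  have -> : #|[pred k | (k \in descents t) || (k == ord_max)]| = #|ord_max |: descents t|.
    by apply: eq_card => k; rewrite !inE orbC.
  rewrite cardsU1 -/d; suff -> : ord_max \notin descents t by [].
  by apply/negP => /descent_neq_max; rewrite eqxx.
have c2 : #|[pred k | ~~ ((k \in descents t) || (k == ord_max))]| = (n - d)%N.
  have := cardC [pred k | (k \in descents t) || (k == ord_max)].
  rewrite c1 card_ord.
  rewrite (eq_card (B := [pred k | ~~ ((k \in descents t) || (k == ord_max))])) //; lia.
transitivity ('X^(d.+2) + ('X^(d.+1) *+ d.+1 + 'X^(d.+2) *+ (n - d)) : {poly R}).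
  by congr ('X^_ + ('X^(_) *+ _ + 'X^(_) *+ _)); [rewrite -c1|rewrite -c2]; apply: eq_card.
rewrite derivXn /= scaler_nat -[in LHS]mulr_natl -['X^(d.+2) *+ _]mulr_natl.
rewrite -['X^d *+ _]mulr_natl -[_ *+ n.+2]mulr_natl natrB //.
rewrite !exprS -!natr1; ring.
Qed.

Lemma eulerian_poly_sum (R : realType) n :
  eulerian_poly R n.+1 = \sum_(s : 'S_n.+1) 'X^(#|descents s|.+1).
Proof.
rewrite /eulerian_poly.
rewrite [RHS](partition_big (fun s : 'S_n.+1 => inord #|descents s| : 'I_n.+1) xpredT) //=.
rewrite big_add1 /= big_mkord; apply: eq_bigr => k _.
rewrite (eq_bigr (fun=> 'X^(k.+1) : {poly R})); last first.
  by move=> s /eqP <-; rewrite inordK // ltnS card_descents_le.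
rewrite sumr_const scaler_nat; congr (_ *+ _); apply: eq_card => s.
rewrite inE eqSS [RHS]unfold_in /= inordK ?ltnS ?card_descents_le //.
Qed.

Lemma eulerian_rec_sum (R : comNzRingType) n :
  eulerian_rec R n.+1 = \sum_(s : 'S_n.+1) 'X^(#|descents s|.+1).
Proof.
elim: n => [|n IH].
  rewrite (eq_bigr (fun=> 'X : {poly R})) => [|s _]; last first.
    by have := card_descents_le s; rewrite leqn0 => /eqP ->.
  by rewrite sumr_const card_Sn /= poly.derivE mulr0 add0r mulr1 scale1r.
rewrite [LHS]/= -/(eulerian_rec R n.+1) IH.
rewrite [RHS](sum_perm_lift ord_max) exchange_big /=.
under [RHS]eq_bigr do rewrite sum_descents_lift.
rewrite big_split /= -mulr_sumr; congr (_ * _ + _); first by rewrite linear_sum.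
by rewrite -scaler_sumr -mulr_sumr.
Qed.

(** For [f_n = E_n / (1 - x)^(n+1)] the recurrence of [eulerian_rec] reads [f_(n+1) = x f_n']. It
    starts at the numerator [1] of [1 / (1 - x)], whereas [eulerian_poly R 0] is an empty sum; hence
    the index [n.+1]. *)
Lemma eulerian_polyE (R : realType) n : eulerian_poly R n.+1 = eulerian_rec R n.+1.
Proof. by rewrite eulerian_poly_sum eulerian_rec_sum. Qed.

(** * Multisection and partial fractions *)

Lemma horner_eulerian_rec1 (R : comNzRingType) n : (eulerian_rec R n).[1] = n`!%:R.
Proof.
elim: n => [|n IH] /=; first by rewrite hornerE.
by rewrite !(hornerE, hornerZ) /= IH subrr mul0r add0r mulr1 factS natrM.
Qed.

(** The sum over permutations consists of [n!] monomials of degree at most [n]. *)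
Lemma norm_horner_eulerian_rec (R : numFieldType) n (z : R) (c : R) :
  1 <= c -> `|z| <= c -> `|(eulerian_rec R n).[z]| <= n`!%:R * c ^+ n.
Proof.
move=> c1 zc; case: n => [|n]; first by rewrite /= hornerE normr1 mul1r.
rewrite eulerian_rec_sum horner_sum (le_trans (ler_norm_sum _ _ _)) //.
rewrite -card_Sn mulr_natl -sumr_const; apply: ler_sum => s _.
rewrite hornerXn normrX (le_trans (lerXn2r _ _ _ zc)) ?nnegrE //.
  exact: le_trans ler01 c1.
by rewrite ler_weXn2l // ltnS card_descents_le.
Qed.

(* The identity is [N^(n+1) f_n(-x^N) = \sum_m f_n(eta_m x)] for
   [f_n(x) = E_n(x) / (1 - x)^(n+1) = (x d/dx)^n (1 / (1 - x))], cleared of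
   denominators by means of [(1 - eta_m x) L_m = 1 + x^N]. *)
Lemma eulerian_rec_multisection (R : comNzRingType) (N n : nat) (eta : 'I_N -> R) :
  (0 < N)%N -> (forall m, eta m ^+ N = -1) ->
  (forall j, (0 < j < N)%N -> \sum_m eta m ^+ j = 0) ->
  N%:R ^+ n.+1 * (eulerian_rec R n \Po (- 'X^N)) =
  \sum_m (eulerian_rec R n \Po (eta m *: 'X)) *
         (\sum_(j < N) (eta m *: 'X) ^+ j) ^+ n.+1.
Proof.
move=> N0 etaN eta0; set P : {poly R} := 1 + 'X^N.
pose L m : {poly R} := \sum_(j < N) (eta m *: 'X) ^+ j.
pose Q m : {poly R} := 1 - eta m *: 'X.
have QL m : Q m * L m = P.
  have := subrX1 (eta m *: 'X : {poly R}) N; rewrite exprZn etaN scaleN1r => h.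
  by rewrite /P /Q -opprB mulNr -h opprB opprK addrC.
elim: n => [|n IH].
  rewrite [RHS](eq_bigr L) => [|m _]; last by rewrite comp_polyC mul1r.
  rewrite comp_polyC /L exchange_big /= mulr1 expr1.
  rewrite (bigD1 (Ordinal N0)) //= [X in _ = _ + X]big1 => [|j j0]; last first.
    under eq_bigr do rewrite exprZn.
    by rewrite -scaler_suml eta0 ?scale0r // ltn_ord andbT lt0n.
  by rewrite addr0 (eq_bigr (fun=> 1)) ?sumr_const ?card_ord.
pose A := eulerian_rec R n \Po - 'X^N.
pose B m := eulerian_rec R n \Po (eta m *: 'X).
(* The right-hand side is the numerator of [x d/dx] applied to [B m / Q m ^ n.+1]. [AS] is the same
   for [A / P ^ n.+1], the factor [N] coming from the chain rule for [x^N]. *)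
have BS m : eulerian_rec R n.+1 \Po (eta m *: 'X) =
    Q m * 'X * (B m)^`() - n.+1%:R * ('X * (Q m)^`()) * B m.
  rewrite /B /Q /= deriv_comp !poly.derivE alg_polyC.
  rewrite comp_polyD comp_polyZ !comp_polyM comp_polyB comp_polyC comp_polyX.
  rewrite scaler_nat -mul_polyC -[_ *+ n.+1]mulr_natl.
  by move: (_ \Po _) (_ \Po _) => a b; ring.
have AS : N%:R * (eulerian_rec R n.+1 \Po - 'X^N) =
    P * 'X * A^`() - n.+1%:R * ('X * P^`()) * A.
  rewrite /A /P /= deriv_comp !poly.derivE.
  rewrite comp_polyD comp_polyZ !comp_polyM comp_polyB comp_polyC comp_polyX.
  have XN : 'X^N = 'X * 'X^(N.-1) :> {poly R} by rewrite -exprS prednK.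
  rewrite scaler_nat -['X^(N.-1) *+ _]mulr_natl -[_ *+ n.+1]mulr_natl !XN.
  by move: (_ \Po _) (_ \Po _) => a b; ring.
rewrite exprSr -mulrA AS.
transitivity (P * 'X * (N%:R ^+ n.+1 * A)^`() - n.+1%:R * ('X * P^`()) * (N%:R ^+ n.+1 * A)).
  have -> : (N%:R ^+ n.+1 * A)^`() = N%:R ^+ n.+1 * A^`().
    by rewrite -natrX !mulr_natl derivMn.
  by ring.
rewrite IH raddf_sum /= !mulr_sumr -sumrB; apply: eq_bigr => m _.
rewrite BS -/(B m) -/(L m) derivM deriv_exp /=.
(* With [P = Q m * L m] differentiated as a product, the terms containing the derivative of [L m]
   cancel. *)
have -> : P^`() = (Q m)^`() * L m + Q m * (L m)^`() by rewrite -derivM QL.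
by rewrite -(QL m) -mulr_natl !exprS; ring.
Qed.

Lemma map_eulerian_rec (R S : nzRingType) (f : {rmorphism R -> S}) n :
  map_poly f (eulerian_rec R n) = eulerian_rec S n.
Proof.
elim: n => [|n IH] /=; first by rewrite rmorph1.
rewrite rmorphD /= map_polyZ !rmorphM /= rmorphB rmorph1 /= !map_polyX.
by rewrite -deriv_map IH rmorph_nat.
Qed.

(** * The unit circle and the N-th roots of -1 *)

Section cis.
Context {R : realType}.
Implicit Types a b u w : R.

Definition cis a : R[i] := Complex (cos a) (sin a).

Lemma cisD a b : cis (a + b) = cis a * cis b.
Proof.
by rewrite /cis cosD sinD; apply/eqP; rewrite eq_complex /= eqxx addrC eqxx.
Qed.

Lemma cis0 : cis 0 = 1.
Proof. by rewrite /cis cos0 sin0. Qed.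

Lemma cisX a n : cis a ^+ n = cis (n%:R * a).
Proof.
elim: n => [|n IH]; first by rewrite mul0r cis0 expr0.
by rewrite exprS IH -cisD -natr1 mulrDl mul1r addrC.
Qed.

Lemma cis_pi : cis pi = -1.
Proof.
by rewrite /cis cospi sinpi; apply/eqP; rewrite eq_complex /= oppr0 !eqxx.
Qed.

Lemma cis_natpi n : cis (n%:R * pi) = (-1) ^+ n.
Proof. by rewrite -cisX cis_pi. Qed.

Lemma sqr_normc_1Bcis w a :
  ComplexField.Normc.normc (1 - w%:C%C * cis a) ^+ 2 = (1 - w) ^+ 2 + 4 * w * sin (a / 2) ^+ 2.
Proof.
rewrite /= sqr_sqrtr ?addr_ge0 ?sqr_ge0 //.
have {1 2 3 4}-> : a = a / 2 + a / 2 by field.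
rewrite !(cosD, sinD); have := cos2Dsin2 (a / 2).
set c := cos _; set s := sin _ => h.
transitivity (1 - 2 * w * (c ^+ 2 + s ^+ 2 - 2 * s ^+ 2) + w ^+ 2 * (c ^+ 2 + s ^+ 2) ^+ 2).
  by ring.
by rewrite h; ring.
Qed.

(** Arguments of the N-th roots of -1. The indices [m = 0] and [m = N - 1] give the conjugate pair
    closest to 1. *)
Definition unity_angle (N m : nat) : R := (m.*2.+1)%:R * (pi / N%:R).

Lemma cis_unity_angleX (N m : nat) : (0 < N)%N -> cis (unity_angle N m) ^+ N = -1.
Proof.
move=> N0; rewrite cisX /unity_angle mulrCA.
have -> : N%:R * (pi / N%:R) = pi :> R by rewrite mulrC divfK // pnatr_eq0 -lt0n.
by rewrite cis_natpi -signr_odd /= odd_double.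
Qed.

(** A geometric sum of ratio [cis (2 * a)] with [a = j pi / N]. The N-th power of the ratio is 1,
    and the ratio itself is not, since [1 - cos (2 a) = 2 sin^2 a] and [0 < a < pi]. *)
Lemma sum_cis_unity_angleX (N j : nat) : (0 < j < N)%N ->
  \sum_(m < N) cis (unity_angle N m) ^+ j = 0.
Proof.
move=> /andP[j0 jN]; have N0 : (0 < N)%N := leq_trans j0 (ltnW jN).
have Nn0 : N%:R != 0 :> R by rewrite pnatr_eq0 -lt0n.
pose a : R := j%:R * (pi / N%:R).
have E m : cis (unity_angle N m) ^+ j = cis a * cis (2 * a) ^+ m.
  rewrite !cisX -cisD; congr cis; rewrite /unity_angle /a -natr1 -muln2 natrM; ring.
under eq_bigr do rewrite E.
rewrite -mulr_sumr.
have a1 : cis (2 * a) - 1 != 0.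
  rewrite subr_eq0; apply/eqP => -[c1 _].
  have : 2 * sin a ^+ 2 = 0.
    have := cos2Dsin2 a; move: c1; have -> : 2 * a = a + a by ring.
    by rewrite cosD -!expr2 => h1 h2; lra.
  have sa : 0 < sin a.
    apply: sin_gt0_pi; rewrite /a mulr_gt0 ?ltr0n ?divr_gt0 ?pi_gt0 ?ltr0n //=.
    by rewrite mulrCA gtr_pMr ?pi_gt0 // ltr_pdivrMr ?ltr0n // mul1r ltr_nat.
  by move/eqP; rewrite mulf_eq0 pnatr_eq0 /= expf_eq0 /= gt_eqF.
have h : (cis (2 * a) - 1) * \sum_(i < N) cis (2 * a) ^+ i = 0.
  rewrite -subrX1 cisX.
  have -> : N%:R * (2 * a) = (j.*2)%:R * pi :> R by rewrite /a -muln2 natrM; field.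
  by rewrite cis_natpi -signr_odd odd_double expr0 subrr.
by move/eqP: h; rewrite mulf_eq0 (negbTE a1) /= => /eqP ->; rewrite mulr0.
Qed.

(** The multisection identity at [x = e^(u/N)], for which [x^N = e^u]. For fixed [m], [N (1 - z m)]
    tends to [- (u + i pi (2m+1))] as N grows, so each summand approaches the contribution of one
    pole. *)
Lemma eulerian_partial_fractions (N n : nat) u : (0 < N)%N ->
  let z m := (expR (u / N%:R))%:C%C * cis (unity_angle N m) in
  ((eulerian_rec R n).[- expR u] / (1 + expR u) ^+ n.+1)%:C%C =
  \sum_(m < N) (eulerian_rec R[i] n).[z m] / (N%:R * (1 - z m)) ^+ n.+1.
Proof.
move=> N0 z; set w := expR (u / N%:R).
have wN : w ^+ N = expR u.
  by rewrite -expRM_natl mulrC divfK // pnatr_eq0 -lt0n.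
have := @eulerian_rec_multisection R[i] N n (fun m => cis (unity_angle N m)) N0
  (fun m => cis_unity_angleX m N0) (@sum_cis_unity_angleX N).
move=> /(congr1 (fun p => p.[w%:C%C])).
rewrite horner_sum hornerM -natrX -polyC_natr hornerC horner_comp hornerN hornerXn.
rewrite -rmorphXn /= wN -rmorphN -(map_eulerian_rec (real_complex R)) horner_map /=.
set S := (eulerian_rec R n).[_] => h.
have p1 : (1 + expR u : R) != 0 by rewrite gt_eqF // addr_gt0 // expR_gt0.
have Nn0 : N%:R != 0 :> R[i] by rewrite pnatr_eq0 -lt0n.
have L m : (1 - z m) * (\sum_(j < N) z m ^+ j) = (1 + expR u)%:C%C.
  have := subrX1 (z m) N; rewrite exprMn -rmorphXn /= wN cis_unity_angleX //.
  by move=> h0; rewrite -(opprB (z m)) mulNr -h0 rmorphD rmorph1; ring.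
have zn m : 1 - z m != 0.
  apply/eqP => e; move: (L m); rewrite e mul0r => /esym/eqP.
  by rewrite -(rmorph0 (real_complex R)) (inj_eq (@complexI R)) (negbTE p1).
rewrite rmorphM fmorphV rmorphXn /=.
apply: (@mulfI _ (N%:R ^+ n.+1)); first by rewrite expf_neq0.
rewrite mulrA -natrX h mulr_suml mulr_sumr; apply: eq_bigr => m _.
rewrite hornerM horner_comp hornerZ hornerX [cis _ * _]mulrC -/(z m).
rewrite horner_exp horner_sum.
under eq_bigr do rewrite horner_exp hornerZ hornerX [cis _ * _]mulrC -/(z m).
rewrite -(L m) !exprMn natrX; set l := \sum_(j < N) _.
have l0 : l != 0.
  apply/eqP => e; move: (L m); rewrite -/l e mulr0 => /esym/eqP.
  by rewrite -(rmorph0 (real_complex R)) (inj_eq (@complexI R)) (negbTE p1).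
move: (expf_neq0 n.+1 l0) (expf_neq0 n.+1 (zn m)) (expf_neq0 n.+1 Nn0).
by move=> x0 y0 v0; rewrite -mulf_div divff // mulr1 mulrA -mulf_div divff // mul1r.
Qed.

End cis.

Local Open Scope classical_set_scope.
Local Open Scope ring_scope.

(** * The two dominant poles *)

Local Notation Re := complex.Re.
Local Notation Im := complex.Im.

Section complex_limits.
Context {R : realType}.
Implicit Types (z : nat -> R[i]) (l : R[i]).

Definition ccvg z l :=
  (Re (z n) @[n --> \oo] --> Re l) /\ (Im (z n) @[n --> \oo] --> Im l).

Lemma ccvg_cst l : ccvg (fun=> l) l.
Proof. by split; exact: cvg_cst. Qed.

Lemma complex_ReD (x y : R[i]) : Re (x + y) = Re x + Re y.
Proof. by case: x y => a b [c d]. Qed.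

Lemma complex_ImD (x y : R[i]) : Im (x + y) = Im x + Im y.
Proof. by case: x y => a b [c d]. Qed.

Lemma ccvgD z1 z2 l1 l2 : ccvg z1 l1 -> ccvg z2 l2 ->
  ccvg (fun n => z1 n + z2 n) (l1 + l2).
Proof.
move=> [r1 i1] [r2 i2]; split; rewrite ?complex_ReD ?complex_ImD.
  by under eq_fun do rewrite complex_ReD; exact: cvgD.
by under eq_fun do rewrite complex_ImD; exact: cvgD.
Qed.

Lemma complex_ReM (x y : R[i]) : Re (x * y) = Re x * Re y - Im x * Im y.
Proof. by case: x y => a b [c d]. Qed.

Lemma complex_ImM (x y : R[i]) : Im (x * y) = Re x * Im y + Im x * Re y.
Proof. by case: x y => a b [c d]. Qed.

Lemma ccvgM z1 z2 l1 l2 : ccvg z1 l1 -> ccvg z2 l2 ->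
  ccvg (fun n => z1 n * z2 n) (l1 * l2).
Proof.
move=> [r1 i1] [r2 i2]; split; rewrite ?complex_ReM ?complex_ImM.
  by under eq_fun do rewrite complex_ReM; apply: cvgB; exact: cvgM.
by under eq_fun do rewrite complex_ImM; apply: cvgD; exact: cvgM.
Qed.

Lemma ccvgX z l n : ccvg z l -> ccvg (fun k => z k ^+ n) (l ^+ n).
Proof.
move=> zl; elim: n => [|n IH]; first by under eq_fun do rewrite expr0; exact: ccvg_cst.
by rewrite exprS; under eq_fun do rewrite exprS; exact: ccvgM.
Qed.

Lemma ccvgV z l : l != 0 -> ccvg z l -> ccvg (fun k => (z k)^-1) l^-1.
Proof.
move=> l0 [r i].
have n0 : Re l ^+ 2 + Im l ^+ 2 != 0.
  by rewrite paddr_eq0 ?sqr_ge0 // !expf_eq0 /=; move: l0; rewrite eq_complex.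
have n2 : (Re (z k) ^+ 2 + Im (z k) ^+ 2)^-1 @[k --> \oo] --> (Re l ^+ 2 + Im l ^+ 2)^-1.
  by apply: cvgV => //; apply: cvgD; under eq_fun do rewrite expr2; exact: cvgM.
have reV (x : R[i]) : Re x^-1 = Re x * (Re x ^+ 2 + Im x ^+ 2)^-1 by case: x.
have imV (x : R[i]) : Im x^-1 = - (Im x * (Re x ^+ 2 + Im x ^+ 2)^-1) by case: x.
split; rewrite ?reV ?imV.
  by under eq_fun do rewrite reV; exact: cvgM.
by under eq_fun do rewrite imV; apply: cvgN; exact: cvgM.
Qed.

Lemma ccvg_horner (p : {poly R[i]}) z l :
  ccvg z l -> ccvg (fun k => p.[z k]) p.[l].
Proof.
move=> zl; elim/poly_ind: p => [|p c IH].
  by rewrite horner0; under eq_fun do rewrite horner0; exact: ccvg_cst.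
rewrite hornerMXaddC; under eq_fun do rewrite hornerMXaddC.
by apply: ccvgD; [exact: ccvgM|exact: ccvg_cst].
Qed.

End complex_limits.

Section main_term.
Context {R : realType}.
Implicit Types (u c : R).

Lemma cvg_difference_quotient (f : R -> R) (l : R) : is_derive (0 : R) (1 : R) f l ->
  (n.+1%:R * (f n.+1%:R^-1 - f 0)) @[n --> \oo] --> l.
Proof.
move=> [df dl].
have : h^-1 *: ((f \o shift 0) (h *: 1) - f 0) @[h --> (0 : R)^'] --> l by rewrite -dl.
move=> /cvgr_dnbhsP /(_ harmonic) h.
have {}h := h (conj (fun n => lt0r_neq0 (harmonic_gt0 n)) cvg_harmonic).
apply: cvg_trans h; apply: near_eq_cvg; near=> n.
by rewrite /= /harmonic /= invrK addr0 [_ *: 1]mulr1.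
Unshelve. all: by end_near. Qed.

(** Write [sin c = 2 sin (c/2) cos (c/2)] and [sin (c/2) = (c/2) cos y] by the mean value theorem.
    Both cosines are at least [cos (pi/4)], whose square is 1/2. *)
Lemma sin_ge_half c : 0 <= c <= pi / 2 -> c / 2 <= sin c.
Proof.
move=> /andP[]; rewrite le_eqVlt => /predU1P[<-|c0 c1]; first by rewrite mul0r sin0.
have p0 := @pi_gt0 R.
have [y yI] : exists2 y, y \in `]0, (c / 2)[ & sin (c / 2) - sin 0 = cos y * (c / 2 - 0).
  apply: MVT; first by rewrite divr_gt0.
  by apply: continuous_subspaceT => x; exact: continuous_sin.
rewrite sin0 !subr0 => sE; move: yI; rewrite in_itv /= => /andP[y0 y1].
have le_cos x : 0 <= x <= pi / 4 -> cos (pi / 4) <= cos x.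
  move=> /andP[x0 x1]; rewrite leNgt ltr_cos ?in_itv /= -?leNgt //; apply/andP; split; lra.
have c4 : cos (pi / 4) ^+ 2 = 1 / 2 :> R.
  have := @cos2Dsin2 R (pi / 4); have := @cos_pihalf R.
  have -> : pi / 2 = pi / 4 + pi / 4 :> R by field.
  by rewrite cosD -!expr2 => *; lra.
have c40 : 0 <= cos (pi / 4) :> R by apply: cos_ge0_pihalf; apply/andP; split; lra.
have h1 : cos (pi / 4) <= cos (c / 2) by apply: le_cos; apply/andP; split; lra.
have h2 : cos (pi / 4) <= cos y by apply: le_cos; apply/andP; split; lra.
have {2}-> : c = c / 2 + c / 2 by field.
rewrite sinD sE.
have : cos (pi / 4) ^+ 2 <= cos (c / 2) * cos y by rewrite expr2 ler_pM.
by rewrite c4 => h; nra.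
Qed.

(** The complex number [e^((u + i c) / N)]. *)
Definition cexp_frac u c (N : nat) : R[i] := (expR (u / N%:R))%:C%C * cis (c / N%:R).

Lemma ReE_cexp_frac u c N : Re (cexp_frac u c N) = expR (u / N%:R) * cos (c / N%:R).
Proof. by rewrite /cexp_frac /cis complex_ReM /= mul0r subr0. Qed.

Lemma ImE_cexp_frac u c N : Im (cexp_frac u c N) = expR (u / N%:R) * sin (c / N%:R).
Proof. by rewrite /cexp_frac /cis complex_ImM /= mul0r addr0. Qed.

Lemma cvg_div_natS c : c / n.+1%:R @[n --> \oo] --> 0.
Proof.
rewrite -(mulr0 c).
apply: (@cvgM _ _ _ _ (fun=> c) harmonic); [exact: cvg_cst|exact: cvg_harmonic].
Qed.

Lemma cvg_comp_div_natS (f : R -> R) c : continuous f ->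
  f (c / n.+1%:R) @[n --> \oo] --> f 0.
Proof. by move=> cf; exact: (cvg_comp _ _ (cvg_div_natS c) (cf 0)). Qed.

Lemma ccvg_cexp_frac u c : ccvg (fun n => cexp_frac u c n.+1) 1.
Proof.
have E := @cvg_comp_div_natS expR u (@continuous_expR R).
split.
  under eq_fun do rewrite ReE_cexp_frac.
  have -> : Re 1 = expR 0 * cos 0 :> R by rewrite expR0 cos0 mulr1.
  by apply: cvgM => //; apply: cvg_comp_div_natS; exact: continuous_cos.
under eq_fun do rewrite ImE_cexp_frac.
have -> : Im 1 = expR 0 * sin 0 :> R by rewrite sin0 mulr0.
by apply: cvgM => //; apply: cvg_comp_div_natS; exact: continuous_sin.
Qed.

Lemma is_derive_expR_mul_comp (f : R -> R) u c df : is_derive (0 : R) (1 : R) f df ->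
  is_derive (0 : R) (1 : R) (fun h => - (expR (u * h) * f (c * h))) (- (u * f 0 + c * df)).
Proof.
move=> d.
have L a : is_derive (0 : R) (1 : R) (fun h => a * h) a.
  have := is_deriveZ a (is_derive_id (0 : R) (1 : R)).
  by rewrite [a *: 1]mulr1.
have d1 : is_derive (0 : R) (1 : R) (expR \o (fun h => u * h)) u.
  have := @is_derive1_comp _ expR (fun h => u * h) 0 _ _ (is_derive_expR _) (L u).
  by rewrite mulr0 expR0 mul1r.
have d2 : is_derive (0 : R) (1 : R) (f \o (fun h => c * h)) (c * df).
  rewrite mulrC; apply: is_derive1_comp; by rewrite mulr0.
have := is_deriveN (is_deriveM d1 d2).
by rewrite /= !mulr0 expR0 [1 *: _]mul1r [_ *: u]mulrC addrC.
Qed.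

(** With [h = 1/N], the real and imaginary parts are difference quotients at 0 of
    [- e^(u h) cos (c h)] and [- e^(u h) sin (c h)]. *)
Lemma ccvg_natS_1Bcexp_frac u c :
  ccvg (fun n => n.+1%:R * (1 - cexp_frac u c n.+1)) (- Complex u c).
Proof.
have nC n : n.+1%:R = (n.+1%:R)%:C%C :> R[i] by rewrite rmorph_nat.
split.
  have := cvg_difference_quotient (@is_derive_expR_mul_comp _ u c _ (is_derive_cos _)).
  have -> : - (u * cos 0 + c * - sin 0) = - u :> R by rewrite cos0 sin0; ring.
  apply: cvg_trans; apply: near_eq_cvg.
  near=> n; rewrite nC complex_ReM complex_ReD; case E : (cexp_frac u c n.+1) => [a b] /=.
  have -> : a = Re (cexp_frac u c n.+1) by rewrite E.
  by rewrite ReE_cexp_frac !mulr0 expR0 cos0; ring.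
have := cvg_difference_quotient (@is_derive_expR_mul_comp _ u c _ (is_derive_sin _)).
have -> : - (u * sin 0 + c * cos 0) = - c :> R by rewrite cos0 sin0; ring.
apply: cvg_trans; apply: near_eq_cvg.
near=> n; rewrite nC complex_ImM complex_ImD; case E : (cexp_frac u c n.+1) => [a b] /=.
have -> : b = Im (cexp_frac u c n.+1) by rewrite E.
by rewrite ImE_cexp_frac !mulr0 expR0 sin0; ring.
Unshelve. all: by end_near. Qed.

Lemma ccvg_main_term n u c : Complex u c != 0 ->
  ccvg (fun k => let z := cexp_frac u c k.+1 in
     (eulerian_rec R[i] n).[z] / (k.+1%:R * (1 - z)) ^+ n.+1)
   (n`!%:R / (- Complex u c) ^+ n.+1).
Proof.
move=> uc0; apply: ccvgM.
  by rewrite -horner_eulerian_rec1; apply: ccvg_horner; exact: ccvg_cexp_frac.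
apply: ccvgV; first by rewrite expf_neq0 // oppr_eq0.
apply: ccvgX; exact: ccvg_natS_1Bcexp_frac.
Qed.
End main_term.

(** * The remaining poles *)

Local Notation normc := ComplexField.Normc.normc.

Section remainder.
Context {R : realType}.
Implicit Types (u w : R).

Lemma normc_ge0 (z : R[i]) : 0 <= normc z.
Proof. by case: z => a b; exact: sqrtr_ge0. Qed.

Lemma Re_le_normc (z : R[i]) : `|complex.Re z| <= normc z.
Proof.
by case: z => a b; rewrite -sqrtr_sqr /= ler_sqrt ?addr_ge0 ?sqr_ge0 // lerDl sqr_ge0.
Qed.

Lemma normcX (z : R[i]) n : normc (z ^+ n) = normc z ^+ n.
Proof.
elim: n => [|n IH]; first by rewrite !expr0 ComplexField.Normc.normc1.
by rewrite !exprS ComplexField.Normc.normcM IH.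
Qed.

Lemma normc_sum n (F : 'I_n -> R[i]) : normc (\sum_i F i) <= \sum_i normc (F i).
Proof.
elim/big_ind2: _ => [|x1 x2 y1 y2 h1 h2|//]; first by rewrite ComplexField.Normc.normc0.
exact: le_trans (le_normcD _ _) (lerD h1 h2).
Qed.

(** Telescoping: [(2m+3)^2 >= 4 (m+1) (m+2)]. The induction carries the exact remainder
    [1 / (4 (M+1))]. *)
Lemma sum_inv_odd_sqr M : \sum_(m < M) ((m.*2.+3)%:R ^+ 2)^-1 <= 1 / 4 :> R.
Proof.
suff : \sum_(m < M) ((m.*2.+3)%:R ^+ 2)^-1 <= 1 / 4 - (4 * M.+1%:R)^-1 :> R.
  by move=> h; apply: le_trans h _; rewrite gerBl invr_ge0 mulr_ge0.
elim: M => [|M IH]; first by rewrite big_ord0 mulr1 div1r subrr.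
rewrite big_ord_recr /= (le_trans (lerD IH (lexx _))) //.
have -> : (M.*2.+3)%:R = 2 * M%:R + 3 :> R by rewrite -addn3 natrD -mul2n natrM.
have -> : M.+1%:R = M%:R + 1 :> R by rewrite natr1.
have -> : M.+2%:R = M%:R + 2 :> R by rewrite -addn2 natrD.
have M0 : 0 <= M%:R :> R by [].
move: M%:R M0 => x x0.
have h : ((2 * x + 3) ^+ 2)^-1 <= (4 * (x + 1) * (x + 2))^-1.
  by rewrite lef_pV2 ?posrE ?exprn_gt0 ?mulr_gt0 //; [nra|lra|lra|lra].
have -> : (4 * (x + 2))^-1 = (4 * (x + 1))^-1 - (4 * (x + 1) * (x + 2))^-1.
  by field; apply/andP; split; apply: lt0r_neq0; lra.
lra.
Qed.

(** Among [N = M+2] roots of -1, the index [m.+1] runs over all but the two extreme ones. The half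
    angle is [(2m+3) pi / (2N)]; if it exceeds [pi/2], the reflection [x -> pi - x] replaces [m] by
    [rev_ord m] and keeps the sine. So [b] is the odd number counted from the nearer end, and
    [sin_ge_half] applies. *)
Lemma sin_unity_angle_ge M (m : 'I_M) : exists b : nat,
  (b = m.*2.+3 \/ b = ((rev_ord m).*2).+3) /\
  (b%:R * pi / 4) ^+ 2 <= (M.+2%:R * sin (unity_angle M.+2 m.+1 / 2)) ^+ 2 :> R.
Proof.
set N : R := M.+2%:R; have N0 : 0 < N by rewrite ltr0n.
have p0 := @pi_gt0 R.
have key (b : nat) : (b%:R * (pi / N) / 2 <= pi / 2) ->
    (b%:R * pi / 4) ^+ 2 <= (N * sin (b%:R * (pi / N) / 2)) ^+ 2.
  move=> h.
  have b0 : 0 <= b%:R * (pi / N) / 2 by rewrite !mulr_ge0 ?invr_ge0 // ltW.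
  have h2 : b%:R * (pi / N) / 2 / 2 <= sin (b%:R * (pi / N) / 2).
    by apply: sin_ge_half; rewrite b0.
  have s0 : 0 <= sin (b%:R * (pi / N) / 2) by apply: le_trans h2; rewrite divr_ge0.
  rewrite lerXn2r ?nnegrE //.
  - by rewrite divr_ge0 // mulr_ge0 // ltW.
  - by rewrite mulr_ge0 // ltW.
  have -> : b%:R * pi / 4 = N * (b%:R * (pi / N) / 2 / 2) by field; rewrite gt_eqF.
  by rewrite ler_wpM2l // ltW.
have E : (m.*2.+3)%:R + ((rev_ord m).*2.+3)%:R = 2 * N :> R.
  rewrite /N -natrD -natrM; congr (_%:R); rewrite /= -!mul2n; have := ltn_ord m.
  by move: (nat_of_ord m) => i iM; rewrite mulnBr; lia.
case: (leP ((m.*2.+3)%:R * (pi / N) / 2) (pi / 2)) => h.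
  by exists m.*2.+3; split; [left|exact: key].
exists ((rev_ord m).*2).+3; split; first by right.
have E2 : (m.*2.+3)%:R * (pi / N) / 2 = pi - ((rev_ord m).*2.+3)%:R * (pi / N) / 2.
  have -> : (m.*2.+3)%:R = 2 * N - ((rev_ord m).*2.+3)%:R :> R by rewrite -E addrK.
  by field; rewrite gt_eqF.
rewrite /unity_angle -/N doubleS E2 sinB sinpi mul0r sub0r cospi mulN1r opprK.
apply: key; move: h; rewrite E2; move: (_ * _ / 2) => X h.
by move: p0 h; move: (pi : R) => p p0 h; lra.
Qed.

Definition fraction_term n u N m : R[i] :=
  let z := (expR (u / N%:R))%:C%C * cis (unity_angle N m) in
  (eulerian_rec R[i] n).[z] / (N%:R * (1 - z)) ^+ n.+1.

(** The denominator [D ^+ k.+2] is split as [D ^+ k * D ^+ 2]. The first factor, with [D >= q],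
    gives the geometric gain over the dominant pair; the second, with [D^2 >= b^2 / 2], makes the
    sum over the poles bounded independently of [M]. As [b >= 3] and [w >= 8/9], the angular part of
    [D^2] is at least [2 pi^2]. The unit lost in the hypothesis on [u ^+ 2 - 1] costs less than
    [pi^2 / 2], which leaves [3/2 pi^2]; any factor above 1 would do. Since [b] is one of two
    numbers, the bound adds both possibilities. *)
Lemma normc_fraction_term k u M (m : 'I_M) :
  let w := expR (u / M.+2%:R) in
  8 / 9 <= w -> w ^+ k.+1 <= 2 -> u ^+ 2 - 1 <= (M.+2%:R * (1 - w)) ^+ 2 ->
  normc (fraction_term k.+1 u M.+2 m.+1) <=
  (2 * (k.+1)`!%:R / Num.sqrt (u ^+ 2 + 3 / 2 * pi ^+ 2) ^+ k) *
   (2 * (((m.*2.+3)%:R ^+ 2)^-1 + (((rev_ord m).*2.+3)%:R ^+ 2)^-1)).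
Proof.
move=> w w1 w2 uw; rewrite /fraction_term /= -/w.
set z := _ * cis _; set D := normc (M.+2%:R * (1 - z)).
set q := Num.sqrt _; have p0 := @pi_gt0 R; have p2 := @pi_ge2 R.
have w0 : 0 < w := expR_gt0 _.
have DE : D ^+ 2 = (M.+2%:R * (1 - w)) ^+ 2 +
    4 * w * (M.+2%:R * sin (unity_angle M.+2 m.+1 / 2)) ^+ 2.
  rewrite /D ComplexField.Normc.normcM exprMn sqr_normc_1Bcis.
  have -> : normc (M.+2%:R : R[i]) = M.+2%:R.
    have -> : (M.+2%:R : R[i]) = (M.+2%:R)%:C%C by rewrite rmorph_nat.
    by rewrite /= expr0n /= addr0 sqrtr_sqr ger0_norm.
  by ring.
have [b [bE hb]] := sin_unity_angle_ge m.
have b3 : 3 <= b%:R :> R by rewrite ler_nat; case: bE => ->.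
have hb2 : w * (b%:R * pi) ^+ 2 / 4 <=
    4 * w * (M.+2%:R * sin (unity_angle M.+2 m.+1 / 2)) ^+ 2.
  have -> : w * (b%:R * pi) ^+ 2 / 4 = 4 * w * (b%:R * pi / 4) ^+ 2 by field.
  by rewrite ler_wpM2l // mulr_ge0 // ltW.
have b9 : 9 <= b%:R ^+ 2 :> R by nra.
have pi4 : 4 <= pi ^+ 2 :> R by nra.
have h1 : 8 / 9 * (b%:R ^+ 2 * pi ^+ 2) <= w * (b%:R * pi) ^+ 2.
  by rewrite exprMn ler_wpM2r // mulr_ge0 ?sqr_ge0.
have h2 : 9 * pi ^+ 2 <= b%:R ^+ 2 * pi ^+ 2 :> R by rewrite ler_wpM2r ?sqr_ge0.
have h3 : b%:R ^+ 2 * 4 <= b%:R ^+ 2 * pi ^+ 2 :> R by rewrite ler_wpM2l ?sqr_ge0.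
have n0 := sqr_ge0 (M.+2%:R * (1 - w)).
have Dq2 : u ^+ 2 + 3 / 2 * pi ^+ 2 <= D ^+ 2 by rewrite DE; lra.
have Db2 : b%:R ^+ 2 / 2 <= D ^+ 2 by rewrite DE; lra.
have D0 : 0 <= D by exact: normc_ge0.
have q0 : 0 < q by rewrite sqrtr_gt0; have := sqr_ge0 u; lra.
have qD : q <= D by rewrite -(ger0_norm D0) -sqrtr_sqr ler_sqrt // sqr_ge0.
have Dpos : 0 < D := lt_le_trans q0 qD.
rewrite ComplexField.Normc.normcM ComplexField.Normc.normcV normcX -/D.
have hE : normc (eulerian_rec R[i] k.+1).[z] <= 2 * (k.+1)`!%:R.
  have zw : `|z| = w%:C%C.
    rewrite normc_def; congr (_%:C)%C.
    rewrite /z complex_ReM complex_ImM /= !mul0r subr0 addr0.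
    rewrite !exprMn -mulrDr cos2Dsin2 mulr1 sqrtr_sqr ger0_norm //; exact: ltW.
  (* The modulus of [z] is [w], possibly below 1, while the bound on the numerator asks for a radius
     at least 1. *)
  have c1 : (1 : R[i]) <= (Num.max 1 w)%:C%C.
    by rewrite -(rmorph1 (real_complex R)) lecR le_max lexx.
  have c2 : `|z| <= (Num.max 1 w)%:C%C by rewrite zw lecR le_max lexx orbT.
  apply: (@le_trans _ _ ((k.+1)`!%:R * Num.max 1 w ^+ k.+1)).
    rewrite -lecR rmorphM rmorphXn rmorph_nat.
    exact: (norm_horner_eulerian_rec k.+1 c1 c2).
  rewrite mulrC ler_wpM2r //; case: (leP 1 w) => //= _; by rewrite expr1n ler1n.
have -> : D ^+ k.+2 = D ^+ k * D ^+ 2 by rewrite -exprD addn2.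
rewrite invfM [leLHS]mulrA; apply: ler_pM.
- by rewrite mulr_ge0 ?invr_ge0 ?exprn_ge0 ?normc_ge0.
- by rewrite invr_ge0 exprn_ge0.
- apply: ler_pM => //; first exact: normc_ge0.
    by rewrite invr_ge0 exprn_ge0.
  by rewrite lef_pV2 ?posrE ?exprn_gt0 // lerXn2r ?nnegrE // ltW.
apply: (@le_trans _ _ (2 * (b%:R ^+ 2)^-1)).
  have -> : 2 * (b%:R ^+ 2)^-1 = (b%:R ^+ 2 / 2)^-1 :> R by rewrite [RHS]invfM invrK mulrC.
  by rewrite lef_pV2 ?posrE ?exprn_gt0 // divr_gt0 // exprn_gt0 //; lra.
rewrite ler_wpM2l //; case: bE => ->; first by rewrite lerDl invr_ge0 sqr_ge0.
by rewrite lerDr invr_ge0 sqr_ge0.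
Qed.

Lemma normc_sum_fraction_term k u M :
  let w := expR (u / M.+2%:R) in
  8 / 9 <= w -> w ^+ k.+1 <= 2 -> u ^+ 2 - 1 <= (M.+2%:R * (1 - w)) ^+ 2 ->
  normc (\sum_(m < M) fraction_term k.+1 u M.+2 m.+1) <=
  2 * (k.+1)`!%:R / Num.sqrt (u ^+ 2 + 3 / 2 * pi ^+ 2) ^+ k.
Proof.
move=> w h1 h2 h3; apply: le_trans (normc_sum _) _.
apply: le_trans (ler_sum _ (fun m _ => normc_fraction_term m h1 h2 h3)) _.
rewrite -mulr_sumr -[leRHS]mulr1 ler_wpM2l ?divr_ge0 ?exprn_ge0 ?sqrtr_ge0 ?mulr_ge0 //.
rewrite -mulr_sumr big_split /=.
have E : \sum_(m < M) (((rev_ord m).*2.+3)%:R ^+ 2)^-1 =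
    \sum_(m < M) ((m.*2.+3)%:R ^+ 2)^-1 :> R.
  by rewrite [RHS](reindex_inj rev_ord_inj).
by have := sum_inv_odd_sqr M; rewrite E => h; lra.
Qed.

End remainder.

(** * Sign of the Eulerian polynomial at the equidistributed angles *)

Section eulerian_sign.
Context {R : realType}.
Implicit Types (u U theta : R).

(** In polar form, [pi cot theta + i c pi = (pi / sin theta) e^(i c theta)]. At [(n+1) theta = j pi]
    its power is real, with the same sign for both conjugate poles. *)
Lemma Re_main_term n theta (j : nat) (c : R) : 0 < sin theta -> c = 1 \/ c = -1 ->
  n.+1%:R * theta = j%:R * pi ->
  complex.Re (n`!%:R / (- Complex (pi * cos theta / sin theta) (c * pi)) ^+ n.+1) =
  (-1) ^+ (n.+1 + j) * (n`!%:R * (sin theta / pi) ^+ n.+1).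
Proof.
move=> s0 c1 E; have sn0 : sin theta != 0 by rewrite gt_eqF.
have p0 : (pi : R) != 0 by rewrite gt_eqF // pi_gt0.
have -> : Complex (pi * cos theta / sin theta) (c * pi) =
    (pi / sin theta)%:C%C * cis (c * theta).
  apply/eqP; rewrite eq_complex complex_ReM complex_ImM /= !mul0r subr0 addr0.
  case: c1 => ->; rewrite ?mulN1r ?mul1r ?cosN ?sinN.
    by apply/andP; split; apply/eqP; field.
  by apply/andP; split; apply/eqP; field.
have -> : (- ((pi / sin theta)%:C%C * cis (c * theta))) ^+ n.+1 =
   (((-1) ^+ (n.+1 + j)) * (pi / sin theta) ^+ n.+1)%:C%C.
  rewrite [LHS]exprNn [X in _ * X]exprMn cisX [n.+1%:R * (c * _)]mulrCA E.
  have -> : cis (c * (j%:R * pi)) = (-1) ^+ j.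
    case: c1 => ->; first by rewrite mul1r cis_natpi.
    apply: (@mulrI _ (cis (j%:R * pi))).
      by rewrite unitfE cis_natpi signr_eq0.
    by rewrite -cisD mulN1r subrr cis0 cis_natpi -exprD addnn -signr_odd odd_double.
  by rewrite [RHS]rmorphM rmorph_sign [in RHS]rmorphXn exprD mulrA mulrAC.
rewrite -(rmorph_nat (real_complex R)) -fmorphV -rmorphM /=.
by rewrite invfM invr_sign mulrCA -exprVn invf_div.
Qed.

Lemma fraction_term_first n u k :
  fraction_term n u k.+1 0 = let z := cexp_frac u (1 * pi) k.+1 in
     (eulerian_rec R[i] n).[z] / (k.+1%:R * (1 - z)) ^+ n.+1.
Proof. by rewrite /fraction_term /cexp_frac /unity_angle !mul1r. Qed.

Lemma fraction_term_last n u k :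
  fraction_term n u k.+1 k = let z := cexp_frac u (-1 * pi) k.+1 in
     (eulerian_rec R[i] n).[z] / (k.+1%:R * (1 - z)) ^+ n.+1.
Proof.
rewrite /fraction_term /cexp_frac.
have -> : unity_angle k.+1 k = 2%:R * pi + -1 * pi / k.+1%:R :> R.
  rewrite /unity_angle -natr1 -muln2 natrM -natr1; field.
  by rewrite ?natr1 ?nat1r pnatr_eq0.
by rewrite cisD cis_natpi sqrrN expr1n mul1r.
Qed.

Lemma eulerian_rec_sign U : exists n0 : nat, forall (n j : nat) theta,
  (n0 <= n)%N -> 0 < sin theta -> `|pi * cos theta / sin theta| <= U ->
  n.+1%:R * theta = j%:R * pi ->
  0 < (-1) ^+ (n.+1 + j) * (eulerian_rec R n).[- expR (pi * cos theta / sin theta)].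
Proof.
pose P : R := pi ^+ 2; have p0 := @pi_gt0 R; have P0 : 0 < P by rewrite exprn_gt0.
(* Since [(x + P) / (x + 3/2 P)] increases with [x], [r] bounds [rho^2 / q^2] for all [|u| <= U]. *)
pose r : R := (U ^+ 2 + P) / (U ^+ 2 + 3 / 2 * P).
have U2 := sqr_ge0 U.
have den0 : 0 < U ^+ 2 + 3 / 2 * P by lra.
have r0 : 0 <= r by rewrite divr_ge0 // ltW //; lra.
have r1 : r < 1 by rewrite ltr_pdivrMr // mul1r; lra.
have [k0 _ hk0] : \forall k \near \oo, 4 * (U ^+ 2 + P) ^+ 2 * r ^+ k <= 1.
  have : geometric (4 * (U ^+ 2 + P) ^+ 2) r x @[x --> \oo] --> 0.
    by apply: cvg_geometric; rewrite ger0_norm.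
  by move=> /(cvgr_le (0 : R)) /(_ 1 ltr01).
exists k0.+1 => -[//|k] j theta; rewrite ltnS => kk0 s0; set u := pi * _ / _ => uU E.
have u2 : u ^+ 2 <= U ^+ 2.
  by rewrite -(ger0_norm (sqr_ge0 u)) normrX lerXn2r ?nnegrE // (le_trans _ uU).
have u20 := sqr_ge0 u.
pose q := Num.sqrt (u ^+ 2 + 3 / 2 * pi ^+ 2).
have q2 : q ^+ 2 = u ^+ 2 + 3 / 2 * P by rewrite sqr_sqrtr // -/P; lra.
have q0 : 0 < q by rewrite sqrtr_gt0 -/P; lra.
pose rho := pi / sin theta; have rho0 : 0 < rho by rewrite divr_gt0.
have rho2 : rho ^+ 2 = u ^+ 2 + P.
  transitivity (pi ^+ 2 * (cos theta ^+ 2 + sin theta ^+ 2) / sin theta ^+ 2).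
    by rewrite cos2Dsin2 mulr1 expr_div_n.
  by rewrite /u /P; field; rewrite gt_eqF.
have rhoE : sin theta / pi = rho^-1 by rewrite invf_div.
clearbody rho.
have rq : rho ^+ 2 <= r * q ^+ 2.
  by rewrite rho2 q2 /r mulrAC ler_pdivlMr //; nra.
(* This says that the remainder is at most the size [L] of one dominant term. It is proved in
   squared form, where only [rho^2 = u^2 + P] and [q^2 = u^2 + 3/2 P] occur; [k0] was chosen for
   that form. *)
have big : 2 * rho ^+ k.+2 <= q ^+ k.
  have rhok0 : 0 <= 2 * rho ^+ k.+2 by rewrite mulr_ge0 // exprn_ge0 // ltW.
  have qk0 : 0 <= q ^+ k by rewrite exprn_ge0 // ltW.
  rewrite -(@ler_pXn2r _ 2) //.
  have -> : (2 * rho ^+ k.+2) ^+ 2 = 4 * (rho ^+ 2) ^+ 2 * (rho ^+ 2) ^+ k.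
    rewrite exprMn.
    have -> : (rho ^+ k.+2) ^+ 2 = (rho ^+ 2) ^+ 2 * (rho ^+ 2) ^+ k.
      by rewrite -exprD -[LHS]exprM -[RHS]exprM mulnC.
    by rewrite mulrA; congr (_ * _ * _); ring.
  rewrite -[leRHS]exprM mulnC [leRHS]exprM.
  apply: (@le_trans _ _ (4 * (U ^+ 2 + P) ^+ 2 * (r * q ^+ 2) ^+ k)).
    apply: ler_pM; rewrite ?mulr_ge0 ?exprn_ge0 ?sqr_ge0 ?(ltW rho0) //.
      rewrite ler_wpM2l // lerXn2r ?nnegrE ?sqr_ge0 //; first by lra.
      by rewrite rho2 lerD2r.
    by rewrite lerXn2r ?nnegrE ?sqr_ge0 // (le_trans _ rq) ?sqr_ge0.
  rewrite exprMn mulrA -[leRHS]mul1r ler_wpM2r ?exprn_ge0 ?(ltW q0) //.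
  exact: hk0.
pose L : R := (k.+1)`!%:R * (sin theta / pi) ^+ k.+2.
have L0 : 0 < L by rewrite mulr_gt0 ?ltr0n ?fact_gt0 // exprn_gt0 // divr_gt0.
have restL : 2 * (k.+1)`!%:R / q ^+ k <= L.
  rewrite /L rhoE exprVn [2 * _]mulrC -mulrA ler_wpM2l //.
  by rewrite ler_pdivrMr ?exprn_gt0 // mulrC ler_pdivlMr ?exprn_gt0.
pose e := (-1) ^+ (k.+2 + j) : R.
have m1 : complex.Re (fraction_term k.+1 u i.+1 0) @[i --> \oo] --> e * L.
  under eq_fun do rewrite fraction_term_first.
  rewrite -(@Re_main_term k.+1 theta j 1) //; last by left.
  apply: (proj1 (ccvg_main_term _ _)).
  by rewrite eq_complex /= negb_and mul1r (gt_eqF p0) orbT.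
have m2 : complex.Re (fraction_term k.+1 u i.+1 i) @[i --> \oo] --> e * L.
  under eq_fun do rewrite fraction_term_last.
  rewrite -(@Re_main_term k.+1 theta j (-1)) //; last by right.
  apply: (proj1 (ccvg_main_term _ _)).
  by rewrite eq_complex /= negb_and mulN1r oppr_eq0 (gt_eqF p0) orbT.
have w1 : expR (u / i.+1%:R) @[i --> \oo] --> (1 : R).
  by have := cvg_comp_div_natS u (@continuous_expR R); rewrite expR0.
have wk : expR (u / i.+1%:R) ^+ k.+1 @[i --> \oo] --> (1 : R).
  have := cvg_comp _ _ w1 (@exprn_continuous R k.+1 1); rewrite expr1n; exact.
have Nw : (i.+1%:R * (1 - expR (u / i.+1%:R))) ^+ 2 @[i --> \oo] --> u ^+ 2.
  have h := cvg_difference_quotient (@is_derive_expR_mul_comp _ _ u 0 _ (is_derive_cos _)).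
  have := cvg_comp _ _ h (@exprn_continuous R 2 _).
  have -> : (- (u * cos 0 + 0 * - sin 0)) ^+ 2 = u ^+ 2 :> R.
    by rewrite cos0 mulr1 mul0r addr0 sqrrN.
  apply: cvg_trans; apply: near_eq_cvg.
  near=> n; rewrite /= !mulr0 !mul0r cos0 expR0 !mulr1; congr (_ ^+ 2); ring.
have m12 : \forall i \near \oo,
   `|e * L + e * L - (complex.Re (fraction_term k.+1 u i.+1 0) +
      complex.Re (fraction_term k.+1 u i.+1 i))| < L.
  have h : (complex.Re (fraction_term k.+1 u i.+1 0) +
      complex.Re (fraction_term k.+1 u i.+1 i)) @[i --> \oo] --> e * L + e * L.
    exact: (cvgD m1 m2).
  by move/cvgrPdist_lt : h; apply.
(* One large [i] meets all the conditions; [0 < i] makes the first and the last pole distinct. *)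
have [i [i0 [c1 [c2 [c3 c4]]]]] : exists i, (0 < i)%N /\
   8 / 9 <= expR (u / i.+1%:R) /\ expR (u / i.+1%:R) ^+ k.+1 <= 2 /\
   u ^+ 2 - 1 <= (i.+1%:R * (1 - expR (u / i.+1%:R))) ^+ 2 /\
   `|e * L + e * L - (complex.Re (fraction_term k.+1 u i.+1 0) +
      complex.Re (fraction_term k.+1 u i.+1 i))| < L.
  near \oo => i; exists i; split; first by near: i; exists 1%N.
  split; first by near: i; apply: (cvgr_ge (1 : R)) => //; lra.
  split; first by near: i; apply: (cvgr_le (1 : R)) => //; lra.
  split; first by near: i; apply: (cvgr_ge (u ^+ 2)) => //; lra.
  by near: i.
case: i i0 c1 c2 c3 c4 => // M _ c1 c2 c3 c4.
have : ((eulerian_rec R k.+1).[- expR u] / (1 + expR u) ^+ k.+2)%:C%C =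
    \sum_(m < M.+2) fraction_term k.+1 u M.+2 m by exact: eulerian_partial_fractions.
rewrite big_ord_recl big_ord_recr.
have -> : \sum_(i < M) fraction_term k.+1 u M.+2 (lift ord0 (widen_ord (leqnSn M) i)) =
  \sum_(m < M) fraction_term k.+1 u M.+2 m.+1 by [].
have -> : nat_of_ord (lift ord0 (@ord_max M)) = M.+1 by [].
move=> /(congr1 (@complex.Re R)).
rewrite complex_ReD complex_ReD [X in X = _ -> _]/=.
have := Re_le_normc (\sum_(m < M) fraction_term k.+1 u M.+2 m.+1).
move=> /le_trans /(_ (normc_sum_fraction_term c1 c2 c3)) /le_trans /(_ restL).
set A := complex.Re (\sum_(_ < _) _); set B := complex.Re (fraction_term _ _ _ 0).
set C := complex.Re (fraction_term _ _ _ M.+1) => AL SE.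
set S := (X in 0 < _ * X).
have q1 : 0 < (1 + expR u) ^+ k.+2 by rewrite exprn_gt0 // addr_gt0 // expR_gt0.
suff : 0 < e * (S / (1 + expR u) ^+ k.+2) by rewrite mulrA pmulr_lgt0 ?invr_gt0.
(* The dominant pair lies strictly within [L] of [2 e L] and the rest is at most [L], so the total
   has the sign of [e]. *)
rewrite SE; move: c4 AL; rewrite -/B -/C /e -signr_odd.
clearbody A B C L; move: (odd _) => o; clear -L0.
case: o; rewrite ?expr1 ?expr0 !ltr_norml !ler_norml => /andP[? ?] /andP[? ?]; lra.
Unshelve. all: by end_near. Qed.

End eulerian_sign.

(** * Counting roots *)

Section root_count.
Context {R : realType}.
Implicit Types (s t : R).

(** The Cauchy distribution function at [ln t / pi], that is, the distribution function of
    [exp(pi Z)] at [t]; meaningful only for [0 < t]. *)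
Definition eulerian_cdf t : R := 1 / 2 + atan (ln t / pi) / pi.

Lemma cot_tan_complement (theta : R) : cos theta / sin theta = tan (pi / 2 - theta).
Proof.
have -> : pi / 2 - theta = - (theta - pi / 2) by ring.
by rewrite /tan sinN cosN sinBpihalf cosBpihalf opprK.
Qed.

Lemma eulerian_root_between U : exists n0 : nat, forall (n j : nat),
  (n0 <= n)%N -> (0 < j)%N -> (j.+1 < n.+1)%N ->
  let th i := i%:R * pi / n.+1%:R in let v i := expR (pi * cos (th i) / sin (th i)) in
  `|pi * cos (th j) / sin (th j)| <= U -> `|pi * cos (th j.+1) / sin (th j.+1)| <= U ->
  exists z, root (eulerian_rec R n) z /\ v j.+1 < - z < v j.
Proof.
have [n0 hn0] := @eulerian_rec_sign R U.
exists n0 => n j nn0 j0 jn th v h1 h2.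
have p0 := @pi_gt0 R.
have n1 : 0 < n.+1%:R :> R by rewrite ltr0n.
have thI i : (0 < i < n.+1)%N -> 0 < th i < pi.
  move=> /andP[i0 i1]; rewrite /th divr_gt0 ?mulr_gt0 ?ltr0n //=.
  by rewrite ltr_pdivrMr // mulrC ltr_pM2l // ltr_nat.
have hj : (0 < j < n.+1)%N by rewrite j0 (ltn_trans _ jn).
have hj1 : (0 < j.+1 < n.+1)%N by rewrite jn.
have sg i : (0 < i < n.+1)%N -> 0 < sin (th i) by move=> /thI; exact: sin_gt0_pi.
have E i : n.+1%:R * th i = i%:R * pi by rewrite mulrC divfK // gt_eqF.
have s1 := hn0 n j (th j) nn0 (sg _ hj) h1 (E j).
have s2 := hn0 n j.+1 (th j.+1) nn0 (sg _ hj1) h2 (E j.+1).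
have vlt : v j.+1 < v j.
  rewrite /v ltr_expR -!mulrA ltr_pM2l // !cot_tan_complement ltr_tan.
  - rewrite ltrD2l ltrN2 /th -!mulrA ltr_pM2r ?divr_gt0 //.
    by rewrite ltr_nat.
  - by have /andP[? ?] := thI _ hj1; rewrite in_itv /=; apply/andP; split; lra.
  - by have /andP[? ?] := thI _ hj; rewrite in_itv /=; apply/andP; split; lra.
have [||z zI rz] := @polyrcf.poly_ivtoo R (eulerian_rec R n) (- v j) (- v j.+1).
- by rewrite lerN2 ltW.
- move: s1 s2; rewrite -/(v j) -/(v j.+1) addnS exprS mulN1r mulNr oppr_gt0 -signr_odd.
  set x := _.[_]; set y := _.[_]; case: (odd _);
    rewrite ?expr1 ?expr0 ?mulN1r ?mul1r => ? ?; nra.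
exists z; split=> //; move: zI; rewrite in_itv /= => /andP[? ?]; apply/andP; split; lra.
Qed.

Lemma ln_tan_atan t : ln t = pi * tan (atan (ln t / pi)).
Proof. by rewrite atanK mulrC divfK // gt_eqF // pi_gt0. Qed.

(** Each gap between consecutive angles [j pi / (n+2)] lying between the angles of [t] and of [s]
    holds a root, and different gaps hold different roots. Rounding the two ends to integers costs
    at most 2. *)
Lemma eulerian_root_count s t : 0 < s -> s < t -> exists n0 : nat,
  forall n (y : nat -> R), (n0 <= n)%N -> eulerian_roots n.+1 y ->
  n.+1%:R * (eulerian_cdf t - eulerian_cdf s) - 2 <=
  #|[set k : 'I_n.+1 | s < - y k.+1 <= t]%SET|%:R.
Proof.
move=> s0 st; have t0 : 0 < t := lt_trans s0 st; have p0 := @pi_gt0 R.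
have [n0 hn0] := @eulerian_root_between (`|ln s| + `|ln t|).
exists n0 => n y nn0 hy.
set N : R := n.+2%:R; have N0 : 0 < N by rewrite ltr0n.
pose th (i : nat) : R := i%:R * pi / N.
pose v i := expR (pi * cos (th i) / sin (th i)).
(* The angle whose cotangent is [ln r / pi]. It decreases with [r], so [t] gives the lower end of
   the range of angles. *)
pose a r : R := pi / 2 - atan (ln r / pi).
have aI r : 0 < a r < pi.
  have := atan_gtNpi2 (ln r / pi); have := atan_ltpi2 (ln r / pi); rewrite /a => h1 h2.
  by apply/andP; split; lra.
pose A := N * a t / pi; pose B := N * a s / pi.
have A0 : 0 <= A by have /andP[h _] := aI t; rewrite ltW // !mulr_gt0 ?invr_gt0.
have B0 : 0 <= B by have /andP[h _] := aI s; rewrite ltW // !mulr_gt0 ?invr_gt0.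
have [A1 A2] : (Num.trunc A)%:R <= A /\ A < (Num.trunc A).+1%:R by apply/andP/truncn_itv.
have [B1 B2] : (Num.trunc B)%:R <= B /\ B < (Num.trunc B).+1%:R by apply/andP/truncn_itv.
(* The least integer above [A] and the largest integer not above [B]. *)
set J0 := (Num.trunc A).+1 in A2; set J1 := Num.trunc B in B1 B2.
have thI i : (J0 <= i <= J1)%N -> [/\ (0 < i < n.+2)%N, a t < th i & th i <= a s].
  move=> /andP[i0 i1].
  have h1 : a t < th i.
    rewrite /th ltr_pdivlMr // -ltr_pdivrMr // [a t * N]mulrC -/A (lt_le_trans A2) //.
    by rewrite ler_nat.
  have h2 : th i <= a s.
    rewrite /th ler_pdivrMr // -ler_pdivlMr // [a s * N]mulrC -/B.
    by rewrite (le_trans _ B1) // ler_nat.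
  split=> //; rewrite (leq_trans _ i0) //= -(ltr_nat R) -/N.
  have /andP[_ h3] := aI s.
  have := le_lt_trans h2 h3; rewrite /th ltr_pdivrMr // mulrC ltr_pM2l //.
have uI i : (J0 <= i <= J1)%N -> ln s <= pi * cos (th i) / sin (th i) < ln t.
  move=> /thI[_ h1 h2]; have /andP[? ?] := aI s; have /andP[? ?] := aI t.
  rewrite -mulrA cot_tan_complement (ln_tan_atan s) (ln_tan_atan t) ler_pM2l // ltr_pM2l //.
  have at_in r : atan (ln r / pi) \in `]- (pi / 2), pi / 2[.
    by rewrite in_itv /= atan_gtNpi2 atan_ltpi2.
  have th_in : pi / 2 - th i \in `]- (pi / 2), pi / 2[.
    by rewrite in_itv /=; apply/andP; split; lra.
  rewrite /a in h1 h2; apply/andP; split.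
    by rewrite leNgt ltr_tan ?at_in // -leNgt; lra.
  by rewrite ltr_tan ?at_in //; lra.
have uU i : (J0 <= i <= J1)%N -> `|pi * cos (th i) / sin (th i)| <= `|ln s| + `|ln t|.
  move=> /uI /andP[h1 h2]; rewrite ler_norml.
  have := ler_norm (ln t); have := ler_norm (- ln s); rewrite normrN.
  have := normr_ge0 (ln t); have := normr_ge0 (ln s) => ? ? ? ?.
  by apply/andP; split; lra.
have vI i : (J0 <= i <= J1)%N -> s <= v i < t.
  move=> /uI /andP[h1 h2]; rewrite -[s]lnK ?posrE // -[t]lnK ?posrE //.
  by rewrite /v ler_expR ltr_expR h1 h2.
have roots (i : 'I_(J1 - J0)) : exists k : 'I_n.+1,
    v (J0 + i).+1 < - y k.+1 < v (J0 + i)%N.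
  have hi : (J0 + i < J1)%N by rewrite -ltn_subRL.
  have i1 : (J0 <= J0 + i <= J1)%N by rewrite leq_addr ltnW.
  have i2 : (J0 <= (J0 + i).+1 <= J1)%N by rewrite hi andbT ltnW // ltnS leq_addr.
  have [/andP[_ h2] _ _] := thI _ i2.
  have [z [rz zI]] := hn0 n.+1 (J0 + i)%N (leqW nn0) isT h2 (uU _ i1) (uU _ i2).
  have : root (eulerian_poly R n.+1) z by rewrite eulerian_polyE.
  move=> /(eulerian_rootsP hy)[[//|k] kn zE].
  by exists (Ordinal (kn : k < n.+1)%N); rewrite /= -zE.
have vmono i j : (J0 <= i)%N -> (i <= j)%N -> (j <= J1)%N -> v j <= v i.
  move=> i0 ij jJ.
  have iI : (J0 <= i <= J1)%N by rewrite i0 (leq_trans ij).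
  have jI : (J0 <= j <= J1)%N by rewrite jJ (leq_trans i0).
  have [_ h1 h2] := thI _ iI; have [_ h3 h4] := thI _ jI.
  have /andP[? ?] := aI s; have /andP[? ?] := aI t.
  have th_in k : a t < th k -> th k <= a s -> pi / 2 - th k \in `]- (pi / 2), pi / 2[.
    by move=> ? ?; rewrite in_itv /=; apply/andP; split; lra.
  rewrite /v ler_expR -!mulrA ler_pM2l // !cot_tan_complement leNgt ltr_tan ?th_in //.
  rewrite -leNgt lerD2l lerN2 /th -!mulrA ler_wpM2r ?ler_nat //.
  by rewrite ltW // divr_gt0.
have [f hf] := choice roots.
have finj : injective f.
  have lt_f (i j : 'I_(J1 - J0)) : (i < j)%N -> f i <> f j.
    move=> ij fij; have /andP[h1 _] := hf i; have /andP[_ h2] := hf j.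
    have : v (J0 + j)%N <= v (J0 + i).+1.
      apply: vmono; rewrite ?ltn_add2l //; first by rewrite leqW // leq_addr.
      by rewrite ltnW // -ltn_subRL.
    rewrite leNgt => /negP; apply; rewrite fij in h1; exact: lt_trans h1 h2.
  move=> i j fij; apply/val_inj; case: (ltngtP i j) => // h; first by have := lt_f _ _ h.
  by have := lt_f _ _ h; rewrite fij.
have card : (J1 - J0 <= #|[set k : 'I_n.+1 | (s < - y k.+1 <= t)%R]%SET|)%N.
  rewrite -[leqLHS]card_ord -(fintype.card_image finj predT); apply: subset_leq_card.
  apply/fintype.subsetP => k /fintype.imageP[i _ ->]; rewrite inE.
  have /andP[h1 h2] := hf i.
  have hi : (J0 + i < J1)%N by rewrite -ltn_subRL.
  have i1 : (J0 <= J0 + i <= J1)%N by rewrite leq_addr ltnW.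
  have i2 : (J0 <= (J0 + i).+1 <= J1)%N by rewrite hi andbT ltnW // ltnS leq_addr.
  have /andP[h3 _] := vI _ i2; have /andP[_ h4] := vI _ i1.
  by rewrite (le_lt_trans h3 h1) (ltW (lt_trans h2 h4)).
(* This remains true when [J1 < J0], the truncated difference then being 0. *)
have h1 : J1%:R <= (J1 - J0)%:R + J0%:R :> R by rewrite -natrD ler_nat addnC -leq_subLR.
have h2 : (J1 - J0)%:R <= #|[set k : 'I_n.+1 | s < - y k.+1 <= t]%SET|%:R :> R.
  by rewrite ler_nat.
have BA : B - A = N * (eulerian_cdf t - eulerian_cdf s).
  rewrite /A /B /a /eulerian_cdf; move: (atan _) (atan _) (lt0r_neq0 p0).
  by move: (pi : R) => p x1 x2 pn; field.
have J0E : J0%:R = (Num.trunc A)%:R + 1 :> R by rewrite natr1.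
have NE : N = n.+1%:R + 1 by rewrite natr1.
have F0 : 0 <= eulerian_cdf t - eulerian_cdf s.
  rewrite subr_ge0 /eulerian_cdf lerD2l ler_pM2r ?invr_gt0 //.
  by apply: le_atan; rewrite ler_pM2r ?invr_gt0 // ler_ln ?posrE // ltW.
rewrite NE mulrDl mul1r in BA; rewrite -natr1 in B2.
lra.
Qed.

End root_count.

(** * The limit law *)

Section eulerian_law.
Context {R : realType}.
Implicit Types (s t : R).
Local Notation leb := (@lebesgue_measure R).

Definition eulerian_density t : R :=
  if 0 < t then (t * (ln t ^+ 2 + pi ^+ 2))^-1 else 0.

Lemma eulerian_density_den_gt0 t : 0 < t -> 0 < t * (ln t ^+ 2 + pi ^+ 2).
Proof. by move=> t0; rewrite mulr_gt0 // ltr_wpDl ?sqr_ge0 // exprn_gt0 // pi_gt0. Qed.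

Lemma eulerian_density_ge0 t : 0 <= eulerian_density t.
Proof.
rewrite /eulerian_density; case: ifP => // t0.
by rewrite invr_ge0 ltW // eulerian_density_den_gt0.
Qed.

Lemma continuous_eulerian_density t : 0 < t -> {for t, continuous eulerian_density}.
Proof.
move=> t0; have : (fun t => (t * (ln t ^+ 2 + pi ^+ 2))^-1) @ t --> eulerian_density t.
  rewrite /eulerian_density t0; apply: cvgV.
    by rewrite gt_eqF // eulerian_density_den_gt0.
  apply: cvgM; first exact: cvg_id.
  apply: cvgD; last exact: cvg_cst.
  under eq_fun do rewrite expr2.
  by rewrite expr2; apply: cvgM; exact: continuous_ln.
apply: cvg_trans; apply: near_eq_cvg; near=> x.
have x0 : 0 < x by near: x; exact: lt_nbhsr.
by rewrite /eulerian_density x0.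
Unshelve. all: by end_near. Qed.

Lemma measurable_eulerian_density : measurable_fun setT eulerian_density.
Proof.
have -> : eulerian_density = eulerian_density \_ `]0, +oo[.
  apply/funext => t; rewrite patchE; case: ifPn => // /negP tn.
  rewrite /eulerian_density ifF //; apply/negP => t0; apply: tn.
  by rewrite inE /= in_itv /= t0.
apply/(measurable_restrictT _ _).1 => //; apply: open_continuous_measurable_fun => //.
by move=> t; rewrite inE /= in_itv /= andbT; exact: continuous_eulerian_density.
Qed.

Lemma is_derive_eulerian_cdf t : 0 < t -> is_derive t 1 eulerian_cdf (eulerian_density t).
Proof.
move=> t0; have p0 := @pi_gt0 R.
have d1 : is_derive t 1 (fun x => ln x / pi) (t^-1 / pi).
  have -> : (fun x => ln x / pi) = pi^-1 \*: (@ln R) by apply/funext => x; rewrite /= mulrC.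
  by rewrite [_ / _]mulrC; apply: is_deriveZ; exact: is_derive1_ln.
have := @is_derive1_comp _ atan (fun x => ln x / pi) t _ _ (is_derive1_atan _) d1.
move=> /(is_deriveZ (pi^-1)) /(is_deriveD (is_derive_cst (1 / 2 : R) t 1)) h.
have -> : @eulerian_cdf R = (fun x : R => 1 / 2 + pi^-1 * atan (ln x / pi)).
  by apply/funext => x; rewrite /eulerian_cdf [pi^-1 * _]mulrC.
suff -> : eulerian_density t =
  0 + pi^-1 *: ((1 + (ln t / pi) ^+ 2)^-1 * (t^-1 / pi)) by exact: h.
rewrite /eulerian_density t0 add0r.
have q0 : 0 < ln t ^+ 2 + pi ^+ 2 by rewrite ltr_wpDl ?sqr_ge0 // exprn_gt0.
have -> : 1 + (ln t / pi) ^+ 2 = (ln t ^+ 2 + pi ^+ 2) / pi ^+ 2.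
  by rewrite mulrDl divff ?expf_neq0 ?gt_eqF // expr_div_n addrC.
move: (ln t ^+ 2 + pi ^+ 2) q0 (lt0r_neq0 p0) => q /lt0r_neq0 qn pn.
rewrite -[RHS]/(_ * _) !invfM invrK.
by move: pn; move: (pi : R) => p pn; field; rewrite pn qn gt_eqF.
Qed.

(** The interval stays away from 0, where the density is unbounded, so that the fundamental theorem
    of calculus applies on a closed segment. *)
Lemma integral_eulerian_density s t : 0 < s -> s < t ->
  (\int[leb]_(x in `]s, t]) (eulerian_density x)%:E = (eulerian_cdf t - eulerian_cdf s)%:E)%E.
Proof.
move=> s0 st; rewrite integral_itv_obnd_cbnd; last first.
  by apply/measurable_EFinP; apply: measurable_funTS; exact: measurable_eulerian_density.
have pos x : x \in `[s, t] -> 0 < x.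
  by rewrite in_itv /= => /andP[+ _]; exact: lt_le_trans.
have cF x : x \in `[s, t] -> {for x, continuous eulerian_cdf}.
  move=> /pos x0; apply: differentiable_continuous; apply/derivable1_diffP.
  by have [] := is_derive_eulerian_cdf x0.
have sI : s \in `[s, t] by rewrite in_itv /= lexx ltW.
have tI : t \in `[s, t] by rewrite in_itv /= lexx ltW.
rewrite EFinB; apply: continuous_FTC2 => //.
- apply: continuous_in_subspaceT => x; rewrite inE => xI.
  by apply: continuous_eulerian_density; exact: pos.
- split.
  + move=> x /subset_itv_oo_cc /pos x0; by have [] := is_derive_eulerian_cdf x0.
  + apply: cvg_at_right_filter; exact: (cF _ sI).
  + apply: cvg_at_left_filter; exact: (cF _ tI).
- move=> x /subset_itv_oo_cc /pos x0; rewrite derive1E.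
  by have [_] := is_derive_eulerian_cdf x0.
Qed.

Lemma integral_cauchy_pdf s t : s < t ->
  (\int[leb]_(x in `]s, t]) (standard_cauchy_pdf x)%:E = ((atan t - atan s) / pi)%:E)%E.
Proof.
move=> st; have p0 := @pi_gt0 R.
have dn0 x : 0 < pi * (1 + x ^+ 2) :> R by rewrite mulr_gt0 // ltr_wpDr ?sqr_ge0.
have dF (x : R) : is_derive x (1 : R) (fun x : R => atan x / pi) (standard_cauchy_pdf x).
  have -> : (fun x : R => atan x / pi) = pi^-1 \*: (@atan R).
    by apply/funext => y; rewrite /= mulrC.
  by rewrite /standard_cauchy_pdf invfM; apply: is_deriveZ; exact: is_derive1_atan.
have cf : continuous (@standard_cauchy_pdf R).
  move=> x; apply: cvgV; first by rewrite gt_eqF.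
  apply: cvgM; first exact: cvg_cst.
  by apply: cvgD; [exact: cvg_cst|exact: exprn_continuous].
have cF : continuous (fun x : R => atan x / pi).
  move=> x; apply: differentiable_continuous; apply/derivable1_diffP.
  by have [] := dF x.
rewrite integral_itv_obnd_cbnd; last first.
  by apply/measurable_EFinP; apply: measurable_funTS; exact: continuous_measurable_fun.
rewrite mulrBl EFinB; apply: (@continuous_FTC2 _ _ (fun x : R => atan x / pi)) => //.
- exact: continuous_subspaceT.
- split.
  + by move=> x _; have [] := dF x.
  + by apply: cvg_at_right_filter; exact: cF.
  + by apply: cvg_at_left_filter; exact: cF.
- by move=> x _; rewrite derive1E; have [_] := dF x.
Qed.

Definition eulerian_law (A : set R) : \bar R :=
  (\int[leb]_(x in A) (eulerian_density x)%:E)%E.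

Let eulerian_law0 : eulerian_law set0 = 0%E.
Proof. by rewrite /eulerian_law integral_set0. Qed.

Let eulerian_law_ge0 A : (0 <= eulerian_law A)%E.
Proof. by apply: integral_ge0 => x _; rewrite lee_fin eulerian_density_ge0. Qed.

Let eulerian_law_sigma_additive : semi_sigma_additive eulerian_law.
Proof.
move=> /= F mF tF mUF; rewrite /eulerian_law; apply: cvg_toP.
  apply: ereal_nondecreasing_is_cvgn => m n mn.
  by apply: lee_sum_nneg_natr => // k _ _; exact: eulerian_law_ge0.
rewrite ge0_integral_bigcup//=.
- by apply/measurable_EFinP; apply: measurable_funTS; exact: measurable_eulerian_density.
- by move=> x _; rewrite lee_fin eulerian_density_ge0.
Qed.

HB.instance Definition _ := isMeasure.Build _ _ _
  eulerian_law eulerian_law0 eulerian_law_ge0 eulerian_law_sigma_additive.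

(* An exhaustion of the open half-line whose masses are explicit. *)
Definition exp_pi_itv (m : nat) : set R := `]expR (- (m%:R * pi)), expR (m%:R * pi)].

Lemma nondecreasing_exp_pi_itv : nondecreasing_seq exp_pi_itv.
Proof.
move=> m n mn; apply/subsetPset; apply: subset_itv; rewrite leBSide /= ler_expR ?lerN2;
  by rewrite ler_wpM2r ?pi_ge0 // ler_nat.
Qed.

Lemma bigcup_exp_pi_itv : \bigcup_m exp_pi_itv m = `]0, +oo[%classic.
Proof.
rewrite /exp_pi_itv; apply/seteqP; split => [x [m _]|x] /=; rewrite !in_itv /= ?andbT.
  by move=> /andP[+ _]; apply: lt_trans; exact: expR_gt0.
move=> x0; exists (Num.trunc `|ln x|).+1 => //=; rewrite in_itv /=.
have h : `|ln x| < (Num.trunc `|ln x|).+1%:R * pi.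
  apply: (@lt_le_trans _ _ (Num.trunc `|ln x|).+1%:R).
    by have /andP[] := truncn_itv (normr_ge0 (ln x)).
  by rewrite ler_peMr //; apply: le_trans (@pi_ge2 R); rewrite ler1n.
rewrite -[x in _ < x]lnK ?posrE // -[x in x <= _]lnK ?posrE // ltr_expR ler_expR.
by move: h; rewrite ltr_norml => /andP[h1 h2]; rewrite h1 ltW.
Qed.

Lemma eulerian_law_exp_pi_itv m :
  eulerian_law (exp_pi_itv m.+1) = (2 * atan m.+1%:R / pi)%:E.
Proof.
have p0 := @pi_gt0 R; have mp : 0 < m.+1%:R * pi :> R by rewrite mulr_gt0.
rewrite /eulerian_law /exp_pi_itv integral_eulerian_density ?expR_gt0 //; last first.
  by rewrite ltr_expR (lt_trans _ mp) // oppr_lt0.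
congr (_%:E); rewrite /eulerian_cdf !expRK mulNr mulfK ?gt_eqF // atanN.
by rewrite mulNr; ring.
Qed.

Lemma cvg_eulerian_law_exp_pi_itv :
  eulerian_law (exp_pi_itv m) @[m --> \oo] --> 1%E.
Proof.
rewrite -(cvg_shiftS (fun m => eulerian_law (exp_pi_itv m))) /=.
under eq_fun do rewrite eulerian_law_exp_pi_itv.
apply: cvg_EFin; first by near=> m.
have E : 2 * (pi / 2) / pi = 1 :> R.
  by rewrite mulrCA divff // mulr1 divff // gt_eqF // pi_gt0.
have h : atan (m%:R : R) @[m --> \oo] --> pi / 2.
  exact: (cvg_comp _ _ cvgr_idn (@cvgy_atan R)).
rewrite -(cvg_shiftS (fun m => atan (m%:R : R))) in h.
have h2 := @cvgM R nat \oo _ _ _ _ _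
  (@cvgM R nat \oo _ _ _ _ _ (cvg_cst (2 : R)) h) (cvg_cst pi^-1).
by rewrite E in h2; exact: h2.
Unshelve. all: by end_near. Qed.

Lemma eulerian_law_pos : eulerian_law `]0, +oo[ = 1%E.
Proof.
have : eulerian_law (exp_pi_itv m) @[m --> \oo] --> eulerian_law (\bigcup_m exp_pi_itv m).
  apply: nondecreasing_cvg_mu; last exact: nondecreasing_exp_pi_itv.
    by move=> m; exact: measurable_itv.
  by rewrite bigcup_exp_pi_itv; exact: measurable_itv.
by rewrite bigcup_exp_pi_itv => h; apply: (cvg_unique _ h cvg_eulerian_law_exp_pi_itv).
Qed.

Lemma eulerian_law_setI_pos A : measurable A ->
  eulerian_law A = eulerian_law (A `&` `]0, +oo[).
Proof.
move=> mA; rewrite /eulerian_law integral_mkcondr; apply: eq_integral => x _.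
rewrite patchE; case: ifPn => // /negP xn; congr (_%:E).
rewrite /eulerian_density ifF //; apply/negP => x0; apply: xn.
by rewrite inE /= in_itv /= x0.
Qed.

Let eulerian_law_setT : eulerian_law setT = 1%E.
Proof. by rewrite eulerian_law_setI_pos // setTI eulerian_law_pos. Qed.

HB.instance Definition _ :=
  Measure_isProbability.Build _ _ R eulerian_law eulerian_law_setT.

(* It is enough to compare masses inside [exp_pi_itv m] and to let [m] grow. *)
Lemma eq_probability_pos (P Q : probability R R) :
  (forall a b : R, 0 < a -> a < b -> P `]a, b]%classic = Q `]a, b]%classic) ->
  P `]0, +oo[%classic = 1%E -> Q `]0, +oo[%classic = 1%E ->
  forall A, measurable A -> P A = Q A.
Proof.
move=> PQ P1 Q1.
have lim (S : probability R R) A : measurable A -> S `]0, +oo[%classic = 1%E ->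
    S (A `&` exp_pi_itv m) @[m --> \oo] --> S A.
  move=> mA S1.
  have -> : S A = S (\bigcup_m (A `&` exp_pi_itv m)).
    rewrite -setI_bigcupr bigcup_exp_pi_itv.
    pose pos : set R := `]0, +oo[%classic.
    have mp : measurable pos by exact: measurable_itv.
    have mpC : measurable (~` pos) by exact: measurableC.
    have S0 : S (~` pos) = 0%E by rewrite probability_setC // S1 subee.
    have S00 : S (A `&` ~` pos) = 0%E.
      apply/eqP; rewrite -measure_le0 -S0; apply: le_measure; rewrite ?inE //.
        exact: measurableI.
    have mAp : measurable (A `&` pos) by exact: measurableI.
    have mApC : measurable (A `&` ~` pos) by exact: measurableI.
    rewrite -[in LHS](setIT A) -(setUv pos) setIUr measureU //.
      by rewrite [X in (_ + X)%E](S00 : _ = _) adde0.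
    by rewrite setIACA setICr setI0.
  apply: nondecreasing_cvg_mu.
  - by move=> m; apply: measurableI => //; exact: measurable_itv.
  - apply: bigcup_measurable => m _; apply: measurableI => //; exact: measurable_itv.
  - move=> m n mn; apply/subsetPset; apply: setIS; apply/subsetPset.
    exact: nondecreasing_exp_pi_itv.
have itvE (a b : R) : P `]a, b]%classic = Q `]a, b]%classic.
  suff E m : P (`]a, b]%classic `&` exp_pi_itv m) = Q (`]a, b]%classic `&` exp_pi_itv m).
    have h1 := lim P `]a, b]%classic (measurable_itv _) P1.
    have h2 := lim Q `]a, b]%classic (measurable_itv _) Q1.
    rewrite (_ : (fun m => P _) = (fun m => Q (`]a, b]%classic `&` exp_pi_itv m))) in h1;
      last first.
      by apply/funext => m; exact: E.
    exact: cvg_unique h1 h2.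
  (* The intersection is again a half-open interval, now with a positive left end, or it is
     empty. *)
  have -> : `]a, b]%classic `&` exp_pi_itv m =
     `](Num.max a (expR (- (m%:R * pi)))), (Num.min b (expR (m%:R * pi)))]%classic.
    rewrite /exp_pi_itv; apply/seteqP; split => x /=; rewrite !in_itv /= gt_max le_min.
      by move=> [/andP[-> ->] /andP[-> ->]].
    by move=> /andP[/andP[-> ->] /andP[-> ->]].
  set a' := Num.max _ _; set b' := Num.min _ _.
  have a0 : 0 < a' by rewrite lt_max expR_gt0 orbT.
  have [ab|ba] := ltP a' b'; first exact: PQ.
  by rewrite set_itv_ge ?bnd_simp -?leNgt // !measure0.
move=> A mA.
apply: (measure_unique (@ocitv R) (fun n => `](- n%:R), n%:R]%classic)) => //.
- exact: ocitvI.
- by move=> i; exact: is_ocitv.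
- apply/seteqP; split => // x _; exists (Num.trunc `|x|).+1 => //=; rewrite in_itv /=.
  have /andP[_] := truncn_itv (normr_ge0 x).
  by rewrite ltr_norml => /andP[-> /ltW ->].
- by move=> _ [[a b] _ <-] /=.
- by move=> k; rewrite (le_lt_trans (probability_le1 _ _)) ?ltry //; exact: measurable_itv.
Qed.

Lemma eulerian_law_support :
  measure_support (eulerian_law : probability R R) = [set t | 0 <= t].
Proof.
apply/seteqP; split => t /= ht.
  rewrite leNgt; apply/negP => t0.
  have := ht `]-oo, 0[%classic (interval_open _ _).
  rewrite /= in_itv /= => /(_ isT isT t0); rewrite [X in (0 < X)%E](_ : _ = 0%E) ?ltxx //.
  rewrite eulerian_law_setI_pos; last exact: measurable_itv.
  rewrite [X in eulerian_law X](_ : _ = set0) ?measure0 //.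
  apply/seteqP; split => // x [] /=; rewrite !in_itv /= andbT => h1 h2.
  by have := lt_trans h1 h2; rewrite ltxx.
move=> U oU Ut.
have [e /= e0 he] : nbhs t U by exact: open_nbhs_nbhs.
(* Placed strictly to the right of [t], so that its ends are positive even for [t = 0]. *)
have sub : `](t + e / 4), (t + e / 2)]%classic `<=` U.
  move=> x /=; rewrite in_itv /= => /andP[h1 h2]; apply: he => /=.
  by rewrite ltr_norml; apply/andP; split; lra.
apply: (@lt_le_trans _ _ (eulerian_law `](t + e / 4), (t + e / 2)]%classic)); last first.
  apply: le_measure; rewrite ?inE //; exact: open_measurable.
rewrite /eulerian_law integral_eulerian_density; [|lra|lra].
rewrite lte_fin subr_gt0 /eulerian_cdf ltrD2l ltr_pM2r ?invr_gt0 ?pi_gt0 //.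
apply: lt_atan; rewrite ltr_pM2r ?invr_gt0 ?pi_gt0 // ltr_ln ?posrE; lra.
Qed.

(** The event that [exp(pi Z)] is in []a, b]] is the event that [Z] is in []ln a / pi, ln b / pi]],
    and both masses are the same difference of arctangents. *)
Lemma eulerian_law_exp_cauchy (d : measure_display) (T : measurableType d)
    (P : probability T R) (Z : {RV P >-> R}) :
  has_density (distribution P Z) (@standard_cauchy_pdf R) ->
  forall A : set R, measurable A -> eulerian_law A = distribution P (exp_pi Z) A.
Proof.
move=> [_ _ hZ]; have p0 := @pi_gt0 R.
apply: (@eq_probability_pos eulerian_law (distribution P (exp_pi Z))).
- move=> a b a0 ab; have b0 := lt_trans a0 ab.
  transitivity (distribution P Z `](ln a / pi), (ln b / pi)]%classic).
    rewrite hZ; last exact: measurable_itv.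
    rewrite integral_cauchy_pdf; last by rewrite ltr_pM2r ?invr_gt0 // ltr_ln.
    rewrite /= /eulerian_law integral_eulerian_density //; congr (_%:E).
    by rewrite /eulerian_cdf mulrBl; ring.
  congr (P _); apply/seteqP; split => w /=; rewrite !in_itv /= /exp_pi.
    by rewrite -{2}[a]lnK ?posrE // -{2}[b]lnK ?posrE // ltr_expR ler_expR
      ltr_pdivrMr // ler_pdivlMr // [pi * _]mulrC.
  by rewrite -{1}[a]lnK ?posrE // -{1}[b]lnK ?posrE // ltr_expR ler_expR
      ltr_pdivrMr // ler_pdivlMr // [pi * _]mulrC.
- exact: eulerian_law_pos.
- transitivity (P setT); last exact: probability_setT.
  congr (P _); apply/seteqP; split => // w _ /=; by rewrite in_itv /= andbT expR_gt0.
Qed.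

Lemma root_measure_itv (y : nat -> R) n s t :
  root_measure y n.+1 `]s, t]%classic =
  (n.+1%:R^-1 * #|[set k : 'I_n.+1 | s < - y k.+1 <= t]%SET|%:R)%:E.
Proof.
rewrite /root_measure /mscale /= /msum EFinM; congr (_ * _)%E.
rewrite (eq_bigr (fun k : 'I_n.+1 => ((s < - y k.+1 <= t)%R%:R : R)%:E)) => [|k _]; last first.
  rewrite /= diracE; congr ((nat_of_bool _)%:R%:E).
  by apply/idP/idP; rewrite inE /= in_itv.
rewrite sumEFin; congr (_%:E).
rewrite -sum1_card natr_sum [RHS]big_mkcond /=; apply: eq_bigr => k _.
by rewrite inE; case: ifP.
Qed.

Lemma root_measure_itv_ge (x : nat -> nat -> R)
    (hx : forall n : nat, (1 <= n)%N -> eulerian_roots n (x n)) s t e :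
  0 < s -> s < t -> 0 < e ->
  \forall n \near \oo, eulerian_cdf t - eulerian_cdf s - e <=
    fine (root_measure (x n.+1) n.+1 `]s, t]%classic).
Proof.
move=> s0 st e0; have [n0 hn0] := eulerian_root_count s0 st.
have h : 2 / n.+1%:R @[n --> \oo] --> (0 : R) by exact: cvg_div_natS.
near=> n.
have n1 : 0 < n.+1%:R :> R by rewrite ltr0n.
have he : 2 / n.+1%:R <= e by near: n; exact: (cvgr_le (0 : R)).
have nn0 : (n0 <= n)%N by near: n; exists n0.
have := hn0 n _ nn0 (hx n.+1 isT); rewrite root_measure_itv /= => hc.
rewrite mulrC ler_pdivlMr //; apply: le_trans hc.
rewrite ler_pdivrMr // in he; nra.
Unshelve. all: by end_near. Qed.

End eulerian_law.

(** * Weak convergence *)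

Section weak_convergence.
Context {R : realType}.
Implicit Types (f : R -> R) (m : probability R R).

Lemma uniform_continuity_segment f a b e : continuous f -> 0 < e ->
  exists2 r, 0 < r & forall x y, a <= x <= b -> `|x - y| < r -> `|f x - f y| <= e.
Proof.
move=> cf e0.
have /compact_near_coveringP := @segment_compact R a b.
move=> /(_ R (0^'+) (fun r x => forall y, `|x - y| < r -> `|f x - f y| <= e) _) h.
have {h} : \forall r \near 0^'+, `[a, b]%classic `<=`
    (fun x => forall y, `|x - y| < r -> `|f x - f y| <= e).
  apply: h => x _.
  have : \forall y \near x, `|f x - f y| < e / 2.
    by move/cvgrPdist_lt : (cf x); apply; rewrite divr_gt0.
  move=> [r /= r0 hr].
  exists (ball x (r / 2), [set q | q < r / 2]).
    split => /=; first by apply: nbhsx_ballx; rewrite divr_gt0.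
    by apply: nbhs_right_lt; rewrite divr_gt0.
  move=> [x' q] /= [hx hq] y hy; have hx' : `|x - x'| < r / 2 by exact: hx.
  have h1 : `|f x - f x'| < e / 2.
    by apply: hr => /=; apply: lt_le_trans hx' _;
      rewrite ler_pdivrMr // ler_peMr ?ler1n // ltW.
  have h2 : `|f x - f y| < e / 2.
    apply: hr => /=; have -> : x - y = (x - x') + (x' - y) by ring.
    by apply: le_lt_trans (ler_normD _ _) _; lra.
  have -> : f x' - f y = - (f x - f x') + (f x - f y) by ring.
  by apply: le_trans (ler_normD _ _) _; rewrite normrN; lra.
move=> h; near (0 : R)^'+ => r; exists r; first by near: r; exact: nbhs_right_gt.
move=> x y xI; have hr : `[a, b]%classic `<=`
    (fun x => forall y, `|x - y| < r -> `|f x - f y| <= e) by near: r.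
by apply: hr; rewrite /= in_itv.
Unshelve. all: by end_near. Qed.

Lemma integrable_continuous_bounded m f M (A : set R) : continuous f ->
  (forall t, `|f t| <= M) -> measurable A -> m.-integrable A (EFin \o f).
Proof.
move=> cf fM mA; apply: measurable_bounded_integrable => //.
- by rewrite (le_lt_trans (probability_le1 _ _)) ?ltry.
- by apply: measurable_funTS; exact: continuous_measurable_fun.
- exists M; split; first exact: num_real.
  by move=> N MN x _ /=; exact: le_trans (fM x) (ltW MN).
Qed.

Definition prob_itv m (s t : R) : R := fine (m `]s, t]%classic).

Lemma prob_itvD m (a b c : R) : a <= b -> b <= c ->
  prob_itv m a c = prob_itv m a b + prob_itv m b c.
Proof.
move=> ab bc; rewrite /prob_itv -fineD ?fin_num_measure //; try exact: measurable_itv.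
congr fine; rewrite -measureU //; try exact: measurable_itv; last first.
  apply/seteqP; split => // x [] /=; rewrite !in_itv /= => /andP[_ h1] /andP[h2 _].
  by have := lt_le_trans h2 h1; rewrite ltxx.
congr (m _); apply/seteqP; split => x /=; rewrite !in_itv /=.
  move=> /andP[-> xc]; have [xb|xb] := leP x b; first by left.
  by right.
move=> [/andP[-> xb]|/andP[bx ->]]; first exact: le_trans xb bc.
by rewrite andbT; exact: le_lt_trans ab bx.
Qed.

Lemma Rintegral_itvD m f M (a b c : R) : continuous f -> (forall t, `|f t| <= M) ->
  a <= b -> b <= c ->
  (\int[m]_(x in `]a, c]) f x = \int[m]_(x in `]a, b]) f x + \int[m]_(x in `]b, c]) f x)%R.
Proof.
move=> cf fM ab bc.
have mab : measurable (`]a, b]%classic : set R) by exact: measurable_itv.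
have mbc : measurable (`]b, c]%classic : set R) by exact: measurable_itv.
have I : m.-integrable (`]a, b] `|` `]b, c])%classic (EFin \o f).
  by apply: (integrable_continuous_bounded m cf fM); exact: measurableU.
rewrite -Rintegral_setU //; last first.
  apply/disj_setPS => x [] /=; rewrite !in_itv /= => /andP[_ h1] /andP[h2 _].
  by have := lt_le_trans h2 h1; rewrite ltxx.
congr (Rintegral m _ f); apply/seteqP; split => x /=; rewrite !in_itv /=.
  move=> /andP[-> xc]; have [xb|xb] := leP x b; first by left.
  by right.
move=> [/andP[-> xb]|/andP[bx ->]]; first exact: le_trans xb bc.
by rewrite andbT; exact: le_lt_trans ab bx.
Qed.

(** One-sided because sign changes show that roots exist without limiting their number. *)
Definition itv_lower (mu_ : nat -> probability R R) m := forall s t e : R,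
  0 < s -> s < t -> 0 < e ->
  \forall n \near \oo, prob_itv m s t - e <= prob_itv (mu_ n) s t.

Lemma Rintegral_lower_itv mu_ m f M e (a b : R) : itv_lower mu_ m ->
  continuous f -> (forall t, 0 <= f t) -> (forall t, `|f t| <= M) -> 0 < e ->
  0 < a -> a < b -> (forall x, a < x <= b -> `|f b - f x| <= e) ->
  forall d : R, 0 < d -> \forall n \near \oo,
    (\int[m]_(x in `]a, b]) f x)%R - 2 * e * prob_itv m a b - d <=
    (\int[mu_ n]_(x in `]a, b]) f x)%R.
Proof.
move=> low cf f0 fM e0 a0 ab osc d d0.
have M0 : 0 <= M := le_trans (normr_ge0 _) (fM 0).
have mab : measurable (`]a, b]%classic : set R) by exact: measurable_itv.
(* A lower bound of [f] on the interval, truncated at 0 because it multiplies a lower bound of the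
   mass. *)
pose c := Num.max 0 (f b - e).
have c0 : 0 <= c by rewrite le_max lexx.
have cM : c <= M.
  by rewrite ge_max M0 /=; have := fM b; rewrite ler_norml => /andP[_ ?]; lra.
have cf' (x : R) : continuous (fun _ : R => x) by move=> y; exact: cvg_cst.
have low_n n : c * prob_itv (mu_ n) a b <= (\int[mu_ n]_(x in `]a, b]) f x)%R.
  rewrite -Rintegral_cst //; apply: le_Rintegral => //.
  - by apply: (integrable_continuous_bounded _ (cf' c) (M := `|c|)).
  - exact: (integrable_continuous_bounded _ cf fM).
  - move=> x; rewrite /= in_itv /= => /osc; rewrite ler_norml => /andP[h1 h2].
    by rewrite ge_max f0 /=; lra.
have up : (\int[m]_(x in `]a, b]) f x)%R <= (c + 2 * e) * prob_itv m a b.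
  rewrite -Rintegral_cst //; apply: le_Rintegral => //.
  - exact: (integrable_continuous_bounded _ cf fM).
  - by apply: (integrable_continuous_bounded _ (cf' _) (M := `|c + 2 * e|)).
  - move=> x; rewrite /= in_itv /= => /osc; rewrite ler_norml => /andP[h1 h2].
    have : f b - e <= c by rewrite le_max lexx orbT.
    by lra.
(* As [c <= M], this loss of mass costs at most [d]; adding 1 covers [M = 0]. *)
have dM : 0 < d / (M + 1) by rewrite divr_gt0 //; lra.
near=> n.
have h : prob_itv m a b - d / (M + 1) <= prob_itv (mu_ n) a b.
  by near: n; exact: low.
have h2 : c * (d / (M + 1)) <= d.
  by rewrite mulrCA ger_pMr // ler_pdivrMr; lra.
have h3 : c * (prob_itv m a b - d / (M + 1)) <= c * prob_itv (mu_ n) a b.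
  by rewrite ler_wpM2l.
have := low_n n; lra.
Unshelve. all: by end_near. Qed.
Lemma Rintegral_lower_segment mu_ m f M e (A B : R) : itv_lower mu_ m ->
  continuous f -> (forall t, 0 <= f t) -> (forall t, `|f t| <= M) -> 0 < e ->
  0 < A -> A < B ->
  forall d : R, 0 < d -> \forall n \near \oo,
    (\int[m]_(x in `]A, B]) f x)%R - 2 * e * prob_itv m A B - d <=
    (\int[mu_ n]_(x in `]A, B]) f x)%R.
Proof.
move=> low cf f0 fM e0 A0 AB.
have [r r0 hr] := @uniform_continuity_segment f A B e cf e0.
(* Enough pieces for each to be shorter than the modulus of continuity [r]. Their number does not
   depend on [n], so finitely many eventual bounds are combined, half of the slack [d] going to each
   new piece. *)
set K := (Num.trunc ((B - A) / r)).+1.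
have K0 : 0 < K%:R :> R by rewrite ltr0n.
pose h := (B - A) / K%:R; have h0 : 0 < h by rewrite divr_gt0 // subr_gt0.
have hr' : h < r.
  have ge0 : 0 <= (B - A) / r by rewrite divr_ge0 ?ltW // subr_gt0.
  have /andP[_] := truncn_itv ge0; rewrite -/K => hK.
  by rewrite /h ltr_pdivrMr // mulrC -ltr_pdivrMr.
pose p (i : nat) := A + i%:R * h.
have pK : p K = B by rewrite /p /h mulrC divfK ?gt_eqF // addrC subrK.
have pS i : p i.+1 = p i + h by rewrite /p -natr1 mulrDl mul1r addrA.
have pA i : A <= p i by rewrite lerDl mulr_ge0 // ltW.
suff key i : (i <= K)%N -> forall d : R, 0 < d -> \forall n \near \oo,
    (\int[m]_(x in `]A, p i]) f x)%R - 2 * e * prob_itv m A (p i) - d <=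
    (\int[mu_ n]_(x in `]A, p i]) f x)%R.
  by have := key K (leqnn _); rewrite pK.
elim: i => [_ d d0|i IH iK d d0].
  have -> : p 0%N = A by rewrite /p mul0r addr0.
  near=> n; rewrite /prob_itv set_itv_ge; last by rewrite bnd_simp ltxx.
  by rewrite !Rintegral_set0 measure0 /= mulr0; lra.
have d2 : 0 < d / 2 by rewrite divr_gt0.
have piS : p i <= p i.+1 by rewrite pS lerDl ltW.
have step : \forall n \near \oo,
    (\int[m]_(x in `](p i), (p i.+1)]) f x)%R - 2 * e * prob_itv m (p i) (p i.+1) - d / 2 <=
    (\int[mu_ n]_(x in `](p i), (p i.+1)]) f x)%R.
  apply: (Rintegral_lower_itv low cf f0 fM e0) => //.
  - exact: lt_le_trans A0 (pA i).
  - by rewrite pS ltrDl.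
  - move=> x /andP[x1 x2]; apply: hr.
      rewrite pA /= -pK /p lerD2l ler_wpM2r ?ler_nat // ltW //.
    by rewrite ger0_norm ?subr_ge0 //; move: x1 x2; rewrite pS => *; lra.
have {}IH := IH (ltnW iK) _ d2.
near=> n.
have h1 : (\int[m]_(x in `]A, p i]) f x)%R - 2 * e * prob_itv m A (p i) - d / 2 <=
    (\int[mu_ n]_(x in `]A, p i]) f x)%R by near: n.
have h2 : (\int[m]_(x in `](p i), (p i.+1)]) f x)%R
    - 2 * e * prob_itv m (p i) (p i.+1) - d / 2 <=
    (\int[mu_ n]_(x in `](p i), (p i.+1)]) f x)%R by near: n.
rewrite (Rintegral_itvD m cf fM (pA i) piS) (Rintegral_itvD (mu_ n) cf fM (pA i) piS).
rewrite (prob_itvD m (pA i) piS); lra.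
Unshelve. all: by end_near. Qed.

Definition tight_pos m := forall e : R, 0 < e ->
  exists A B : R, [/\ 0 < A, A < B & 1 - e <= prob_itv m A B].

(** Off the segment, the integral against [mu_ n] is nonnegative and is dropped; only the tail under
    [m] has to be small. *)
Lemma Rintegral_lower mu_ m f M : itv_lower mu_ m -> tight_pos m ->
  continuous f -> (forall t, 0 <= f t) -> (forall t, `|f t| <= M) ->
  forall e : R, 0 < e -> \forall n \near \oo,
    (\int[m]_x f x)%R - e <= (\int[mu_ n]_x f x)%R.
Proof.
move=> low tight cf f0 fM e e0.
have M0 : 0 <= M := le_trans (normr_ge0 _) (fM 0).
have M1 : 0 < M + 1 by lra.
(* Budget: [e / 4] for the tail under [m], [2 * (e / 8)] for the oscillation of [f], and [e / 4] for
   the convergence on the segment. *)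
have e4 : 0 < e / 4 / (M + 1) by rewrite !divr_gt0.
have e8 : 0 < e / 8 by rewrite divr_gt0.
have e2 : 0 < e / 4 by rewrite divr_gt0.
have [A [B [A0 AB tAB]]] := tight _ e4.
pose S : set R := `]A, B]%classic.
have mS : measurable S by exact: measurable_itv.
have mSC : measurable (~` S) by exact: measurableC.
have cM : continuous (fun _ : R => M) by move=> y; exact: cvg_cst.
have split_T (q : probability R R) : (\int[q]_x f x)%R =
    (\int[q]_(x in S) f x)%R + (\int[q]_(x in ~` S) f x)%R.
  rewrite -{1}(setUv S) Rintegral_setU //; last exact/disj_setPCl.
  by apply: (integrable_continuous_bounded _ cf fM); rewrite setUv.
have tail : (\int[m]_(x in ~` S) f x)%R <= M * (1 - prob_itv m A B).
  have -> : 1 - prob_itv m A B = fine (m (~` S)).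
    rewrite probability_setC // fineB ?fin_num_measure //.
  rewrite -Rintegral_cst //; apply: le_Rintegral => //.
  - exact: (integrable_continuous_bounded _ cf fM).
  - exact: (integrable_continuous_bounded _ cM (M := `|M|)).
  - by move=> x _; exact: le_trans (ler_norm _) (fM x).
have pr1 : prob_itv m A B <= 1.
  by rewrite /prob_itv -lee_fin fineK ?fin_num_measure //; exact: probability_le1.
have h1 : M * (1 - prob_itv m A B) <= e / 4.
  have h : 1 - prob_itv m A B <= e / 4 / (M + 1) by lra.
  apply: le_trans (ler_wpM2l M0 h) _.
  by rewrite mulrCA ger_pMr // ler_pdivrMr //; lra.
near=> n.
have := split_T m; have := split_T (mu_ n).
have tn : 0 <= (\int[mu_ n]_(x in ~` S) f x)%R by apply: Rintegral_ge0 => x _.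
have : (\int[m]_(x in S) f x)%R - 2 * (e / 8) * prob_itv m A B - e / 4 <=
    (\int[mu_ n]_(x in S) f x)%R.
  by near: n; exact: (Rintegral_lower_segment low cf f0 fM e8 A0 AB e2).
move=> h2 h3 h4; nra.
Unshelve. all: by end_near. Qed.

(* Lower bounds suffice: applied to [M + f] and [M - f] they give both inequalities. *)
Lemma weakly_converges_itv_lower mu_ m : itv_lower mu_ m -> tight_pos m ->
  weakly_converges mu_ m.
Proof.
move=> low tight f cf [M fM].
have mT : measurable (setT : set R) by [].
have int (q : probability R R) : q.-integrable setT (EFin \o f).
  exact: (integrable_continuous_bounded q cf fM mT).
have RE (q : probability R R) : (\int[q]_t (f t)%:E = (\int[q]_t f t)%R%:E)%E.
  by rewrite /Rintegral fineK //; exact: (integrable_fin_num mT (int q)).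
under eq_fun do rewrite RE.
rewrite RE; apply: cvg_EFin; first by near=> n.
have cM : continuous (fun _ : R => M) by move=> y; exact: cvg_cst.
have intM (q : probability R R) : q.-integrable setT (EFin \o (fun _ : R => M)).
  exact: (integrable_continuous_bounded q cM (M := `|M|)).
have bound t : - M <= f t <= M by rewrite -ler_norml.
have RM (q : probability R R) : (\int[q]_t M)%R = M.
  by rewrite Rintegral_cst // [fine _](congr1 fine (probability_setT q)) mulr1.
have RD (q : probability R R) : (\int[q]_t (M + f t))%R = M + (\int[q]_t f t)%R.
  by rewrite (RintegralD mT (intM q) (int q)) RM.
have RB (q : probability R R) : (\int[q]_t (M - f t))%R = M - (\int[q]_t f t)%R.
  by rewrite (RintegralB mT (intM q) (int q)) RM.
apply/cvgrPdist_le => e e0.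
have cD : continuous (fun t => M + f t) by move=> t; apply: cvgD; [exact: cvg_cst|exact: cf].
have cB : continuous (fun t => M - f t) by move=> t; apply: cvgB; [exact: cvg_cst|exact: cf].
have D0 t : 0 <= M + f t by have /andP[? ?] := bound t; lra.
have B0 t : 0 <= M - f t by have /andP[? ?] := bound t; lra.
have DM t : `|M + f t| <= 2 * M by rewrite ger0_norm //; have /andP[? ?] := bound t; lra.
have BM t : `|M - f t| <= 2 * M by rewrite ger0_norm //; have /andP[? ?] := bound t; lra.
near=> n.
have h1 : (\int[m]_t (M + f t))%R - e <= (\int[mu_ n]_t (M + f t))%R.
  by near: n; exact: (Rintegral_lower low tight cD D0 DM e0).
have h2 : (\int[m]_t (M - f t))%R - e <= (\int[mu_ n]_t (M - f t))%R.
  by near: n; exact: (Rintegral_lower low tight cB B0 BM e0).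
rewrite !RD in h1; rewrite !RB in h2.
by rewrite /= ler_norml; apply/andP; split; lra.
Unshelve. all: by end_near. Qed.

End weak_convergence.

Theorem theorem1 (R : realType) (x : nat -> nat -> R)
    (hx : forall n : nat, (1 <= n)%N -> eulerian_roots n (x n)) :
  exists mu : probability R R,
    [/\ weakly_converges (fun n : nat => root_measure (x n.+1) n.+1) mu,
        measure_support mu = [set t : R | 0 <= t],
        forall (d : measure_display) (T : measurableType d)
          (P : probability T R) (Z : {RV P >-> R}),
          has_density (distribution P Z) (@standard_cauchy_pdf R) ->
          forall A : set R, measurable A ->
            mu A = distribution P (exp_pi Z) A
      & has_density mu (fun t : R =>
          if 0 < t then (t * (ln t ^+ 2 + pi ^+ 2))^-1 else 0)].
Proof.
exists eulerian_law; split.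
- apply: weakly_converges_itv_lower.
    move=> s t e s0 st e0.
    have E : prob_itv eulerian_law s t = eulerian_cdf t - eulerian_cdf s.
      by rewrite /prob_itv /= /eulerian_law integral_eulerian_density.
    rewrite E; exact: root_measure_itv_ge.
  move=> e e0.
  have := @cvg_eulerian_law_exp_pi_itv R.
  rewrite -(cvg_shiftS (fun m => eulerian_law (exp_pi_itv m))) /=.
  under eq_fun do rewrite eulerian_law_exp_pi_itv.
  move=> /fine_cvg /cvgrPdist_le /(_ e e0) [N _ /(_ N (leqnn N))] /= h.
  (* The segment of mass [2 atan (N+1) / pi]; the shifted index makes it nonempty. *)
  exists (expR (- (N.+1%:R * pi))), (expR (N.+1%:R * pi)); split.
  - exact: expR_gt0.
  - by rewrite ltr_expR gtrN // mulr_gt0 // pi_gt0.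
  - have -> : prob_itv eulerian_law (expR (- (N.+1%:R * pi))) (expR (N.+1%:R * pi)) =
      2 * atan N.+1%:R / pi :> R.
      exact: (congr1 fine (eulerian_law_exp_pi_itv N)).
    by move: h; rewrite ler_norml => /andP[_]; lra.
- exact: eulerian_law_support.
- by move=> d T P Z hZ A mA; exact: eulerian_law_exp_cauchy.
- split; [exact: measurable_eulerian_density|exact: eulerian_density_ge0|by []].
Qed.
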